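(* Let $\gamma\in(1,3]$, $m\in\{1,2\}$, and let $P_*=(V_*,C_* )$ be either $P_6$ with $z\in[z_m,z_M]$ or $P_8$ with $z\in(0,z_M]$. Let $c_1<0$ be the negative root of $-G_Cc^2+(F_C-G_V)c+F_V=0$ (partials at $P_*$). Then there is a unique sequence $(c_\ell)_{\ell\ge0}$ with $c_0=C_*$ and this $c_1$ such that the formal series $C(V)=\sum_{\ell\ge0}c_\ell(V-V_* )^\ell$ satisfies $(1+V)F(V,C(V);\gamma,z)=(1+V)C'(V)G(V,C(V);\gamma,z)$ as formal power series; moreover, for every $\alpha\in(1,2)$ there is $K=K(\gamma,z)>1$ with $|c_\ell|\le K^{\ell-\alpha}/\ell^3$ for all $\ell\ge2$. Consequently there is $\epsilon=\epsilon(\gamma,z)>0$ such that the series converges absolutely on $(V_*-\epsilon,V_*+\epsilon)$ and defines the unique real-analytic solution of $\frac{dC}{dV}=\frac FG$ near $V_*$ with $C(V_* )=C_*$ and $C'(V_* )=c_1$. This solution depends continuously on $(\gamma,z)$.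
   Context: Fix $m\in\{1,2\}$ and $\gamma\in(1,3]$. For $z>0$ put $\lambda=1+m\gamma z$, $a_1=1+\frac{m(\gamma-1)}{2}$, $a_2=\frac{m(\gamma-1)+mz\gamma(\gamma-3)}{2}$, $a_3=\frac{mz\gamma(\gamma-1)}{2}$, $G(V,C;\gamma,z)=C^2[(m+1)V+2mz]-V(1+V)(\lambda+V)$, $F(V,C;\gamma,z)=C\{C^2[1+\frac{mz}{1+V}]-a_1(1+V)^2+a_2(1+V)-a_3\}$; subscripts $C,V$ denote partial derivatives. $z_M=(\sqrt\gamma+\sqrt2)^{-2}$, $z_m=\frac{\gamma-1}{(2\gamma-1)(\gamma+1)}$; for $z\in(0,z_M]$, $w(z)=\sqrt{1-2(\gamma+2)z+(\gamma-2)^2z^2}$, $V_6=\frac{-1+(\gamma-2)z-w}{2}$, $C_6=1+V_6$, $V_8=\frac{-1+(\gamma-2)z+w}{2}$, $C_8=1+V_8$, $P_6=(V_6,C_6)$, $P_8=(V_8,C_8)$. (At $P_*$ one has $F=G=0$ and $1+V_*=C_*$; the negative root $c_1$ exists and is unique in the stated ranges.) *)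

(* Defs.v *)
From Stdlib Require Import Reals Lra.
From Coquelicot Require Import Coquelicot.
Open Scope R_scope.

Definition lam (m g z : R) : R := 1 + m * g * z.
Definition a1 (m g : R) : R := 1 + m * (g - 1) / 2.
Definition a2 (m g z : R) : R := (m * (g - 1) + m * z * g * (g - 3)) / 2.
Definition a3 (m g z : R) : R := m * z * g * (g - 1) / 2.

Definition Gf (m g z V C : R) : R :=
  C ^ 2 * ((m + 1) * V + 2 * m * z) - V * (1 + V) * (lam m g z + V).

Definition Ff (m g z V C : R) : R :=
  C * (C ^ 2 * (1 + m * z / (1 + V)) - a1 m g * (1 + V) ^ 2
       + a2 m g z * (1 + V) - a3 m g z).

Definition Fhat (m g z V C : R) : R :=
  C * (C ^ 2 * ((1 + V) + m * z) - a1 m g * (1 + V) ^ 3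
       + a2 m g z * (1 + V) ^ 2 - a3 m g z * (1 + V)).

Lemma Fhat_spec (m g z V C : R) : 1 + V <> 0 -> (1 + V) * Ff m g z V C = Fhat m g z V C.
Proof. intros H. unfold Ff, Fhat. field. exact H. Qed.

Definition zM (g : R) : R := / (sqrt g + sqrt 2) ^ 2.
Definition zm (g : R) : R := (g - 1) / ((2 * g - 1) * (g + 1)).
Definition wf (g z : R) : R := sqrt (1 - 2 * (g + 2) * z + (g - 2) ^ 2 * z ^ 2).

Definition V6 (g z : R) : R := (-1 + (g - 2) * z - wf g z) / 2.
Definition V8 (g z : R) : R := (-1 + (g - 2) * z + wf g z) / 2.

Inductive branch := P6 | P8.

Definition Vstar (br : branch) (g z : R) : R :=
  match br with P6 => V6 g z | P8 => V8 g z end.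
Definition Cstar (br : branch) (g z : R) : R := 1 + Vstar br g z.

Definition admissible (m : R) (br : branch) (g z : R) : Prop :=
  (m = 1 \/ m = 2) /\ 1 < g <= 3 /\
  match br with
  | P6 => zm g <= z <= zM g
  | P8 => 0 < z <= zM g
  end.

Definition G_C m br g z := Derive (fun C => Gf m g z (Vstar br g z) C) (Cstar br g z).
Definition G_V m br g z := Derive (fun V => Gf m g z V (Cstar br g z)) (Vstar br g z).
Definition F_C m br g z := Derive (fun C => Ff m g z (Vstar br g z) C) (Cstar br g z).
Definition F_V m br g z := Derive (fun V => Ff m g z V (Cstar br g z)) (Vstar br g z).

Definition is_c1 (m : R) (br : branch) (g z c : R) : Prop :=
  c < 0 /\
  - G_C m br g z * c ^ 2 + (F_C m br g z - G_V m br g z) * c + F_V m br g z = 0.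

Definition fps := nat -> R.
Definition fconst (a : R) : fps := fun n => match n with O => a | _ => 0 end.
Definition fX : fps := fun n => match n with 1%nat => 1 | _ => 0 end.
Definition fadd (a b : fps) : fps := fun n => a n + b n.
Definition fscal (k : R) (a : fps) : fps := fun n => k * a n.
Definition fsub (a b : fps) : fps := fun n => a n - b n.
Definition fmul (a b : fps) : fps :=
  fun n => sum_f_R0 (fun i => a i * b (n - i)%nat) n.
Definition fderiv (a : fps) : fps := fun n => INR (S n) * a (S n).

Definition fG (m g z : R) (v c : fps) : fps :=
  fsub (fmul (fmul c c) (fadd (fscal (m + 1) v) (fconst (2 * m * z))))
       (fmul v (fmul (fadd (fconst 1) v) (fadd (fconst (lam m g z)) v))).

Definition fFhat (m g z : R) (v c : fps) : fps :=
  let w := fadd (fconst 1) v in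
  fmul c (fsub (fadd (fsub (fmul (fmul c c) (fadd w (fconst (m * z))))
                           (fscal (a1 m g) (fmul w (fmul w w))))
                     (fscal (a2 m g z) (fmul w w)))
               (fscal (a3 m g z) w)).

Definition formal_sol (m g z Vs : R) (c : fps) : Prop :=
  let v := fadd (fconst Vs) fX in
  forall n : nat,
    fFhat m g z v c n = fmul (fadd (fconst 1) v) (fmul (fderiv c) (fG m g z v c)) n.

Definition analytic_on (f : R -> R) (a b : R) : Prop :=
  forall x0, a < x0 < b ->
    exists r, 0 < r /\ exists d : nat -> R,
      forall x, Rabs (x - x0) < r -> is_pseries d (x - x0) (f x).

(* Main.v *)
Require Import Defs.
From Stdlib Require Import Reals Lra Lia FunctionalExtensionality.
From Coquelicot Require Import Coquelicot.
Open Scope R_scope.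

(** At the critical point the slope c1 < 0 is an eigendirection of the vector field (G, F), with eigenvalue mu1 = G_V + c1 G_C; the other eigenvalue is mu2 = F_C - c1 G_C. The signs G_C < 0, F_V < 0 and G_V > 0 at P_* give mu1 > 0 and mu2 < mu1, so the factors n mu1 - mu2 met when solving for the coefficients never vanish. With C = C_* + x (c1 + y) and b = C_*, the equation becomes the Briot-Bouquet equation b (mu1 x y' + (mu1 - mu2) y) = x A(x, y) - (y + x y') (b G_C y + x B(x, y)), solved by a majorant argument in a weighted l^1 norm. The bounds hold uniformly near a given (gamma, z) and each coefficient is continuous in (gamma, z), whence the continuous dependence. *)

(** * Formal power series *)

(** The obstacle is the term [x y'], which multiplies the n-th coefficient by n and could destroy
    convergence. In the nonlinear part it occurs only within [y + x y'], multiplied by a series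
    without constant term, while the linear part divides the n-th coefficient by [n mu + nu]. With
    [mu] and [nu] positive this divisor is at least n times a positive constant, so one step of the
    iteration is bounded in a single norm, with no loss of radius. Positivity of [nu] says that the
    parabola defining the slope descends at its negative root. A second difficulty is that
    parameters near (gamma, z) may be inadmissible, for instance beyond z_M. The series is therefore
    built by total formulas on the whole plane, and only continuity in the parameters is asked for,
    since w is not differentiable in z at z_M. *)

Definition ftail (a : fps) : fps := fun n => a (S n).
Definition fopp (a : fps) : fps := fun n => - a n.
(** The Euler operator [x d/dx], in which the linear part of the Briot-Bouquet equation is
    diagonal. *)
Definition feuler (a : fps) : fps := fun n => INR n * a n.

Lemma fmul_0 (a b : fps) : fmul a b 0%nat = a 0%nat * b 0%nat.
Proof. reflexivity. Qed.

Lemma fmul_Sl (a b : fps) n : fmul a b (S n) = a 0%nat * b (S n) + fmul (ftail a) b n.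
Proof.
  unfold fmul, ftail. rewrite decomp_sum by lia. simpl pred.
  replace (S n - 0)%nat with (S n) by lia. reflexivity.
Qed.

Lemma fmul_Sr (a b : fps) n : fmul a b (S n) = fmul a (ftail b) n + a (S n) * b 0%nat.
Proof.
  unfold fmul, ftail. simpl sum_f_R0. replace (n - n)%nat with O by lia. f_equal.
  apply sum_eq. intros i Hi. f_equal. f_equal. destruct i; lia.
Qed.

Lemma fmul_comm (a b : fps) : fmul a b = fmul b a.
Proof.
  extensionality n. revert a b. induction n as [|n IH]; intros a b.
  - rewrite !fmul_0. ring.
  - rewrite fmul_Sl, fmul_Sr, IH. ring.
Qed.

Lemma fmul_addl (a b c : fps) : fmul (fadd a b) c = fadd (fmul a c) (fmul b c).
Proof.
  extensionality n. unfold fmul, fadd. rewrite <- sum_plus. apply sum_eq. intros; ring.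
Qed.

Lemma fmul_scall k (a b : fps) : fmul (fscal k a) b = fscal k (fmul a b).
Proof.
  extensionality n. unfold fmul, fscal. rewrite scal_sum. apply sum_eq. intros; ring.
Qed.

Lemma ftail_mul (a b : fps) :
  ftail (fmul a b) = fadd (fscal (a 0%nat) (ftail b)) (fmul (ftail a) b).
Proof. extensionality n. unfold ftail at 1. rewrite fmul_Sl. reflexivity. Qed.

Lemma fmul_assoc (a b c : fps) : fmul a (fmul b c) = fmul (fmul a b) c.
Proof.
  extensionality n. revert a b c. induction n as [|n IH]; intros a b c.
  - rewrite !fmul_0. ring.
  - rewrite (fmul_Sl a), (fmul_Sl (fmul a b)), ftail_mul, fmul_addl, fmul_scall.
    rewrite fmul_Sl, fmul_0. unfold fadd at 1, fscal at 1. rewrite <- IH. ring.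
Qed.

Lemma fconst_mull k (a : fps) : fmul (fconst k) a = fscal k a.
Proof.
  extensionality n. destruct n as [|n].
  - reflexivity.
  (* The tail of a constant is zero; written as 0 times itself, it is removed from the product by
     linearity. *)
  - rewrite fmul_Sl. replace (ftail (fconst k)) with (fscal 0 (ftail (fconst k))).
    + rewrite fmul_scall. unfold fscal, fconst. ring.
    + extensionality j. unfold fscal, ftail, fconst. ring.
Qed.

(** Allows [ring] to check the reduction of the field equation, once the scalars have been split by
    the [fconst] morphism lemmas below. *)
Lemma fps_ring_theory :
  ring_theory (fconst 0) (fconst 1) fadd fmul fsub fopp (@eq fps).
Proof.
  split; intros; try (extensionality n; unfold fadd, fsub, fopp, fconst; try destruct n; ring).
  - rewrite fconst_mull. extensionality n. unfold fscal. ring.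
  - apply fmul_comm.
  - apply fmul_assoc.
  - apply fmul_addl.
Qed.

Add Ring fps_ring : fps_ring_theory.

Lemma fscal_fconst k (a : fps) : fscal k a = fmul (fconst k) a.
Proof. symmetry; apply fconst_mull. Qed.

Lemma fconst_add a b : fconst (a + b) = fadd (fconst a) (fconst b).
Proof. extensionality n. unfold fconst, fadd. destruct n; ring. Qed.

Lemma fconst_sub a b : fconst (a - b) = fsub (fconst a) (fconst b).
Proof. extensionality n. unfold fconst, fsub. destruct n; ring. Qed.

Lemma fconst_opp a : fconst (- a) = fopp (fconst a).
Proof. extensionality n. unfold fconst, fopp. destruct n; ring. Qed.

Lemma fconst_mul a b : fconst (a * b) = fmul (fconst a) (fconst b).
Proof. rewrite fconst_mull. extensionality n. unfold fconst, fscal. destruct n; ring. Qed.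

Lemma fX_mul_0 (a : fps) : fmul fX a 0%nat = 0.
Proof. rewrite fmul_0. unfold fX. ring. Qed.

Lemma fX_mul_S (a : fps) n : fmul fX a (S n) = a n.
Proof.
  rewrite fmul_Sl. replace (ftail fX) with (fconst 1).
  - rewrite fconst_mull. unfold fX, fscal. ring.
  - extensionality j. unfold ftail, fX, fconst. destruct j; reflexivity.
Qed.

Lemma fderiv_fX_mul k (a : fps) :
  fderiv (fadd (fconst k) (fmul fX a)) = fadd a (feuler a).
Proof.
  extensionality n. unfold fderiv. unfold fadd. rewrite fX_mul_S. unfold feuler, fconst.
  rewrite S_INR. ring.
Qed.

(* A truncated weighted l^1 norm: being submultiplicative, it replaces the convolution estimates with weights l^-3. *)
Definition fnorm (r : R) (a : fps) (n : nat) : R := sum_f_R0 (fun k => Rabs (a k) * r ^ k) n.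

Lemma fnorm_term_nonneg r (a : fps) k : 0 <= r -> 0 <= Rabs (a k) * r ^ k.
Proof. intros. apply Rmult_le_pos. apply Rabs_pos. now apply pow_le. Qed.

Lemma fnorm_nonneg r a n : 0 <= r -> 0 <= fnorm r a n.
Proof. intros. apply cond_pos_sum. intros; now apply fnorm_term_nonneg. Qed.

Lemma fnorm_S r a n : fnorm r a (S n) = fnorm r a n + Rabs (a (S n)) * r ^ S n.
Proof. reflexivity. Qed.

Lemma fnorm_le_S r a n : 0 <= r -> fnorm r a n <= fnorm r a (S n).
Proof.
  intros. rewrite fnorm_S. generalize (fnorm_term_nonneg r a (S n) H). lra.
Qed.

Lemma fnorm_split r a n :
  fnorm r a (S n) = Rabs (a 0%nat) + r * fnorm r (ftail a) n.
Proof.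
  unfold fnorm. rewrite decomp_sum by lia. simpl pred. rewrite scal_sum.
  f_equal. simpl; ring. apply sum_eq. intros; unfold ftail; simpl; ring.
Qed.

Lemma fnorm_ge_term r a n k : 0 <= r -> (k <= n)%nat -> Rabs (a k) * r ^ k <= fnorm r a n.
Proof.
  intros Hr Hk. induction n as [|n IH].
  - assert (k = 0)%nat by lia; subst. unfold fnorm; simpl; lra.
  - destruct (Nat.eq_dec k (S n)) as [->|E].
    + rewrite fnorm_S. generalize (fnorm_nonneg r a n Hr). lra.
    + eapply Rle_trans; [apply IH; lia | now apply fnorm_le_S].
Qed.

Lemma fnorm_le r a b n :
  0 <= r -> (forall k, (k <= n)%nat -> Rabs (a k) <= Rabs (b k)) -> fnorm r a n <= fnorm r b n.
Proof.
  intros Hr H. apply sum_Rle. intros k Hk. apply Rmult_le_compat_r.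
  now apply pow_le. now apply H.
Qed.

Lemma fnorm_const r k n : fnorm r (fconst k) n = Rabs k.
Proof.
  induction n as [|n IH].
  - unfold fnorm; simpl; ring.
  - rewrite fnorm_S, IH. unfold fconst. rewrite Rabs_R0. ring.
Qed.

Lemma fnorm_add r a b n : 0 <= r -> fnorm r (fadd a b) n <= fnorm r a n + fnorm r b n.
Proof.
  intros. unfold fnorm. rewrite <- sum_plus. apply sum_Rle. intros k _.
  rewrite <- Rmult_plus_distr_r. apply Rmult_le_compat_r. now apply pow_le. apply Rabs_triang.
Qed.

Lemma fnorm_opp r a n : fnorm r (fopp a) n = fnorm r a n.
Proof. apply sum_eq. intros. unfold fopp. now rewrite Rabs_Ropp. Qed.

Lemma fsub_fopp (a b : fps) : fsub a b = fadd a (fopp b).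
Proof. ring. Qed.

Lemma fnorm_sub r a b n : 0 <= r -> fnorm r (fsub a b) n <= fnorm r a n + fnorm r b n.
Proof.
  intros. rewrite fsub_fopp. rewrite <- (fnorm_opp r b). now apply fnorm_add.
Qed.

Lemma fnorm_scal r k a n : fnorm r (fscal k a) n = Rabs k * fnorm r a n.
Proof.
  unfold fnorm. rewrite scal_sum. apply sum_eq. intros. unfold fscal. rewrite Rabs_mult. ring.
Qed.

(** Induction on the truncation, with a = a_0 + x a': the product is a_0 b + x a' b, and the second
    part needs only truncation one order lower. Truncated sums spare every convergence
    hypothesis. *)
Lemma fnorm_mul r a b n : 0 <= r -> fnorm r (fmul a b) n <= fnorm r a n * fnorm r b n.
Proof.
  intros Hr. revert a b. induction n as [|n IH]; intros a b.
  - unfold fnorm. simpl. rewrite fmul_0, Rabs_mult. lra.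
  - rewrite fnorm_split, ftail_mul, fmul_0, Rabs_mult.
    rewrite (fnorm_split r a).
    eapply Rle_trans.
    { apply Rplus_le_compat_l, Rmult_le_compat_l; [exact Hr|]. apply fnorm_add; exact Hr. }
    rewrite fnorm_scal.
    assert (H1 := IH (ftail a) b). assert (H2 := fnorm_le_S r b n Hr).
    assert (H3 := fnorm_nonneg r (ftail a) n Hr).
    rewrite (fnorm_split r b) in *.
    assert (H4 : fnorm r (ftail a) n * fnorm r b n
      <= fnorm r (ftail a) n * (Rabs (b 0%nat) + r * fnorm r (ftail b) n))
      by (apply Rmult_le_compat_l; lra).
    assert (H5 : r * fnorm r (fmul (ftail a) b) n
      <= r * (fnorm r (ftail a) n * (Rabs (b 0%nat) + r * fnorm r (ftail b) n)))
      by (apply Rmult_le_compat_l; lra).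
    nra.
Qed.

Lemma fnorm_X_mul r a n : 0 <= r -> fnorm r (fmul fX a) n <= r * fnorm r a n.
Proof.
  intros Hr. destruct n as [|n].
  - unfold fnorm; simpl. rewrite fX_mul_0, Rabs_R0.
    assert (H := Rabs_pos (a 0%nat)). nra.
  - rewrite fnorm_split, fX_mul_0, Rabs_R0.
    replace (ftail (fmul fX a)) with a.
    + assert (H := fnorm_le_S r a n Hr). nra.
    + extensionality k. unfold ftail. now rewrite fX_mul_S.
Qed.

Lemma fX_norm r n : 0 <= r -> fnorm r fX n <= r.
Proof.
  intros Hr. replace fX with (fmul fX (fconst 1)) by ring.
  eapply Rle_trans. now apply fnorm_X_mul. rewrite fnorm_const, Rabs_R1. lra.
Qed.

(** * Continuity in the parameters and tame maps on series *)

Section ContinuousParameters.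
Context {U : UniformSpace}.
Implicit Types (p q : U) (f : U -> R) (Y Z : U -> fps).

Lemma continuous_Rplus f (k : U -> R) p :
  continuous f p -> continuous k p -> continuous (fun x => f x + k x) p.
Proof. intros; apply (continuous_plus (V := R_NormedModule)); assumption. Qed.

Lemma continuous_Ropp f p : continuous f p -> continuous (fun x => - f x) p.
Proof. intros; apply (continuous_opp (V := R_NormedModule)); assumption. Qed.

Lemma continuous_Rminus f (k : U -> R) p :
  continuous f p -> continuous k p -> continuous (fun x => f x - k x) p.
Proof. intros; apply (continuous_minus (V := R_NormedModule)); assumption. Qed.

Lemma continuous_Rmult f (k : U -> R) p :
  continuous f p -> continuous k p -> continuous (fun x => f x * k x) p.
Proof. intros; apply (continuous_mult (K := R_AbsRing)); assumption. Qed.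

Lemma continuous_Rdiv f (k : U -> R) p :
  continuous f p -> continuous k p -> k p <> 0 -> continuous (fun x => f x / k x) p.
Proof.
  intros Hf Hk H. apply continuous_Rmult; [exact Hf|].
  apply (continuous_comp k Rinv); [exact Hk | now apply continuous_Rinv].
Qed.

Lemma continuous_pow f p n : continuous f p -> continuous (fun x => f x ^ n) p.
Proof.
  intros Hf. induction n as [|n IH]; simpl.
  - apply continuous_const.
  - now apply continuous_Rmult.
Qed.

Lemma continuous_Rsqrt f p : continuous f p -> continuous (fun x => sqrt (f x)) p.
Proof. intros Hf. apply (continuous_comp f sqrt); [exact Hf | apply continuous_sqrt]. Qed.

Lemma continuous_sum_f_R0 (a : nat -> U -> R) p n :
  (forall i, (i <= n)%nat -> continuous (a i) p) ->
  continuous (fun x => sum_f_R0 (fun i => a i x) n) p.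
Proof.
  induction n as [|n IH]; intros H; simpl.
  - apply H; lia.
  - apply continuous_Rplus; [apply IH; intros; apply H; lia | apply H; lia].
Qed.

Lemma continuous_eps f p :
  continuous f p -> forall e, 0 < e -> locally p (fun q => Rabs (f q - f p) < e).
Proof.
  intros Hf e He. apply (Hf (fun y => Rabs (y - f p) < e)).
  exists (mkposreal e He). intros y Hy. exact Hy.
Qed.

Lemma continuous_locally_gt f p t : continuous f p -> t < f p -> locally p (fun q => t < f q).
Proof.
  intros Hf Ht. generalize (continuous_eps f p Hf (f p - t) ltac:(lra)).
  apply filter_imp. intros q Hq. apply Rabs_lt_between in Hq. lra.
Qed.

Lemma continuous_locally_abs_le f p :
  continuous f p -> locally p (fun q => Rabs (f q) <= Rabs (f p) + 1).
Proof.
  intros Hf. generalize (continuous_eps f p Hf 1 ltac:(lra)).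
  apply filter_imp. intros q Hq.
  replace (f q) with ((f q - f p) + f p) by ring.
  eapply Rle_trans; [apply Rabs_triang | lra].
Qed.

Definition continuous_coefs Y p := forall n, continuous (fun q => Y q n) p.

Lemma continuous_coefs_mul Y Z p :
  continuous_coefs Y p -> continuous_coefs Z p ->
  continuous_coefs (fun q => fmul (Y q) (Z q)) p.
Proof.
  intros HY HZ n. unfold fmul.
  apply (continuous_sum_f_R0 (fun i q => Y q i * Z q (n - i)%nat)).
  intros. apply continuous_Rmult; [apply HY | apply HZ].
Qed.

Lemma continuous_coefs_fixed (a : fps) p : continuous_coefs (fun _ => a) p.
Proof. intros n. apply continuous_const. Qed.

(* Satisfied by every polynomial map whose coefficients are continuous at p. *)
Definition tame p (T : U -> fps -> fps) : Prop :=
  (forall q n y y', (forall k, (k <= n)%nat -> y k = y' k) -> T q y n = T q y' n) /\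
  (exists M, locally p (fun q => forall r y n,
      0 <= r <= 1 -> fnorm r y n <= 1 -> fnorm r (T q y) n <= M)) /\
  (forall Y, continuous_coefs Y p -> continuous_coefs (fun q => T q (Y q)) p).

Lemma tame_const (k : U -> R) p : continuous k p -> tame p (fun q _ => fconst (k q)).
Proof.
  intros Hk. split; [|split].
  - reflexivity.
  - exists (Rabs (k p) + 1). generalize (continuous_locally_abs_le k p Hk).
    apply filter_imp. intros q Hq r y n _ _. now rewrite fnorm_const.
  - intros Y _ [|n]; unfold fconst; [exact Hk | apply continuous_const].
Qed.

Lemma tame_X p : tame p (fun _ _ => fX).
Proof.
  split; [|split].
  - reflexivity.
  - exists 1. apply filter_forall. intros q r y n Hr _.
    eapply Rle_trans; [apply fX_norm|]; lra.
  - intros Y _. apply continuous_coefs_fixed.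
Qed.

Lemma tame_id p : tame p (fun _ y => y).
Proof.
  split; [|split].
  - intros q n y y' H. apply H; lia.
  - exists 1. apply filter_forall. tauto.
  - tauto.
Qed.

Lemma tame_add p T S : tame p T -> tame p S -> tame p (fun q y => fadd (T q y) (S q y)).
Proof.
  intros (T1 & (M & T2) & T3) (S1 & (N & S2) & S3). split; [|split].
  - intros q n y y' H. unfold fadd. now rewrite (T1 q n y y' H), (S1 q n y y' H).
  - exists (M + N). generalize (filter_and _ _ T2 S2). apply filter_imp.
    intros q [HT HS] r y n Hr Hy. eapply Rle_trans; [apply fnorm_add; lra|].
    apply Rplus_le_compat; auto.
  - intros Y HY n. apply continuous_Rplus; [apply T3 | apply S3]; assumption.
Qed.

Lemma tame_mul p T S : tame p T -> tame p S -> tame p (fun q y => fmul (T q y) (S q y)).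
Proof.
  intros (T1 & (M & T2) & T3) (S1 & (N & S2) & S3). split; [|split].
  - intros q n y y' H. apply sum_eq. intros i Hi.
    rewrite (T1 q i y y'), (S1 q (n - i)%nat y y'); try reflexivity; intros; apply H; lia.
  - exists (M * N). generalize (filter_and _ _ T2 S2). apply filter_imp.
    intros q [HT HS] r y n Hr Hy. eapply Rle_trans; [apply fnorm_mul; lra|].
    apply Rmult_le_compat; auto; apply fnorm_nonneg; lra.
  - intros Y HY. apply continuous_coefs_mul; [apply T3 | apply S3]; assumption.
Qed.

Lemma tame_opp p T : tame p T -> tame p (fun q y => fopp (T q y)).
Proof.
  intros (T1 & (M & T2) & T3). split; [|split].
  - intros q n y y' H. unfold fopp. now rewrite (T1 q n y y' H).
  - exists M. revert T2. apply filter_imp. intros q HT r y n Hr Hy.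
    rewrite fnorm_opp. auto.
  - intros Y HY n. apply continuous_Ropp. now apply T3.
Qed.

Lemma tame_sub p T S : tame p T -> tame p S -> tame p (fun q y => fsub (T q y) (S q y)).
Proof. intros HT HS. exact (tame_add p T _ HT (tame_opp p S HS)). Qed.

End ContinuousParameters.

(** * Briot–Bouquet equations *)

(* Coefficientwise form of mu x y' + nu y = x A(y) - (y + x y') (h y + x B(y)) with y(0) = 0. *)
Definition bb_rhs (h : R) (A B : fps -> fps) (y : fps) : fps :=
  fsub (fmul fX (A y)) (fmul (fadd y (feuler y)) (fadd (fscal h y) (fmul fX (B y)))).

Definition bb_solution (mu nu h : R) (A B : fps -> fps) (y : fps) : Prop :=
  y 0%nat = 0 /\
  forall n, (INR (S n) * mu + nu) * y (S n) = bb_rhs h A B y (S n).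

Definition bb_step (mu nu h : R) (A B : fps -> fps) (y : fps) : fps :=
  fun n => match n with O => 0 | S _ => bb_rhs h A B y n / (INR n * mu + nu) end.

Fixpoint bb_iter (mu nu h : R) (A B : fps -> fps) (k : nat) : fps :=
  match k with
  | O => fconst 0
  | S k => bb_step mu nu h A B (bb_iter mu nu h A B k)
  end.

(** The diagonal of the iterates: the n-th coefficient is read at step n, from which on it no longer
    changes. *)
Definition bb_sol mu nu h A B : fps := fun n => bb_iter mu nu h A B n n.

Definition causal (T : fps -> fps) : Prop :=
  forall n y y', (forall k, (k <= n)%nat -> y k = y' k) -> T y n = T y' n.

Section BriotBouquet.
Variables (mu nu h : R) (A B : fps -> fps).
Hypotheses (cA : causal A) (cB : causal B).

(** This makes the recursion well founded. The factor x delays [A] and [B] by one order, and in the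
    product the two extreme terms, the only ones that could reach order n + 1 of y, are killed by
    y(0) = 0. *)
Lemma bb_rhs_causal n y y' : y 0%nat = 0 -> y' 0%nat = 0 ->
  (forall k, (k <= n)%nat -> y k = y' k) -> bb_rhs h A B y (S n) = bb_rhs h A B y' (S n).
Proof.
  intros y0 y0' H. unfold bb_rhs. unfold fsub at 1 2. rewrite !fX_mul_S.
  f_equal; [now apply cA|]. apply sum_eq. intros i Hi.
  destruct (Nat.eq_dec i 0) as [->|Hi0].
  { unfold fadd at 1 3, feuler. rewrite y0, y0'. simpl INR. ring. }
  destruct (Nat.eq_dec i (S n)) as [->|HiS].
  { rewrite Nat.sub_diag. unfold fadd at 2 4, fscal. rewrite !fX_mul_0, y0, y0'. ring. }
  unfold fadd, feuler, fscal. rewrite (H i) by lia. f_equal.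
  destruct (S n - i)%nat as [|j] eqn:E; [lia|].
  rewrite !fX_mul_S, (H (S j)) by lia. f_equal. apply cB. intros; apply H; lia.
Qed.

Lemma bb_iter_0 k : bb_iter mu nu h A B k 0%nat = 0.
Proof. destruct k; reflexivity. Qed.

(** Each step fixes one more coefficient, by causality of the right-hand side. *)
Lemma bb_iter_stable n : forall k j, (n <= k)%nat -> (n <= j)%nat ->
  forall i, (i <= n)%nat -> bb_iter mu nu h A B k i = bb_iter mu nu h A B j i.
Proof.
  induction n as [|n IH]; intros k j Hk Hj i Hi.
  - assert (i = 0)%nat by lia; subst. now rewrite !bb_iter_0.
  - destruct k as [|k]; [lia|]. destruct j as [|j]; [lia|]. simpl.
    destruct i as [|i]; [reflexivity|]. unfold bb_step. f_equal.
    apply bb_rhs_causal; try apply bb_iter_0. intros l Hl. apply IH; lia.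
Qed.

Lemma bb_sol_iter n k : (n <= k)%nat -> bb_sol mu nu h A B n = bb_iter mu nu h A B k n.
Proof. intros. apply (bb_iter_stable n); lia. Qed.

Hypotheses (mu_pos : 0 < mu) (nu_pos : 0 < nu).

Lemma bb_denom_pos n : 0 < INR n * mu + nu.
Proof. assert (H := pos_INR n). nra. Qed.

Lemma bb_sol_correct : bb_solution mu nu h A B (bb_sol mu nu h A B).
Proof.
  split; [reflexivity|]. intros n.
  transitivity (bb_rhs h A B (bb_iter mu nu h A B n) (S n)).
  - change (bb_sol mu nu h A B (S n))
      with (bb_rhs h A B (bb_iter mu nu h A B n) (S n) / (INR (S n) * mu + nu)).
    assert (H := bb_denom_pos (S n)). revert H. generalize (INR (S n) * mu + nu).
    intros d Hd. field. lra.
  - apply bb_rhs_causal; try apply bb_iter_0.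
    intros k Hk. symmetry. now apply bb_sol_iter.
Qed.

Lemma bb_solution_unique y y' :
  bb_solution mu nu h A B y -> bb_solution mu nu h A B y' -> y = y'.
Proof.
  intros [y0 Hy] [y0' Hy'].
  assert (E : forall n k, (k <= n)%nat -> y k = y' k).
  { induction n as [|n IH]; intros k Hk.
    - assert (k = 0)%nat by lia; subst. lra.
    - destruct (Nat.eq_dec k (S n)) as [->|]; [|apply IH; lia].
      apply Rmult_eq_reg_l with (INR (S n) * mu + nu); [|apply Rgt_not_eq, bb_denom_pos].
      rewrite Hy, Hy'. now apply bb_rhs_causal. }
  extensionality n. now apply (E n).
Qed.
End BriotBouquet.

(** Since 1 + i <= 2 (n + 1) for i <= n + 1, the loss caused by [x d/dx] can be pulled out of the
    convolution as one factor n + 1, which the divisor in [bb_step] then absorbs. *)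
Lemma Rabs_fmul_euler (y w : fps) n :
  Rabs (fmul (fadd y (feuler y)) w (S n))
  <= INR (S n) * (2 * fmul (fun k => Rabs (y k)) (fun k => Rabs (w k)) (S n)).
Proof.
  unfold fmul. eapply Rle_trans; [apply Rsum_abs|].
  rewrite !scal_sum. apply sum_Rle. intros i Hi.
  rewrite Rabs_mult. unfold fadd, feuler.
  replace (y i + INR i * y i) with ((1 + INR i) * y i) by ring.
  rewrite Rabs_mult, (Rabs_pos_eq (1 + INR i)) by (generalize (pos_INR i); lra).
  assert (H1 : INR i <= INR (S n)) by (apply le_INR; lia).
  assert (H2 : 1 <= INR (S n)) by (rewrite S_INR; generalize (pos_INR n); lra).
  assert (H3 := Rmult_le_pos _ _ (Rabs_pos (y i)) (Rabs_pos (w (S n - i)%nat))).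
  nra.
Qed.

(** The divisor [INR n * mu + nu] is at least n [kappa], which cancels the factor n of
    [Rabs_fmul_euler]. Using [kappa] in place of [mu] makes the bound uniform over nearby
    parameters. *)
Lemma bb_step_norm mu nu h A B kappa r y n :
  0 < kappa <= mu -> 0 < nu -> 0 <= r ->
  fnorm r (bb_step mu nu h A B y) n
  <= / kappa * (r * fnorm r (A y) n
                + 2 * fnorm r y n * (Rabs h * fnorm r y n + r * fnorm r (B y) n)).
Proof.
  intros Hk Hnu Hr.
  set (w := fadd (fscal h y) (fmul fX (B y))).
  (* A coefficientwise majorant of the step, free of the Euler operator. *)
  set (d := fscal (/ kappa) (fadd (fun k => Rabs (fmul fX (A y) k))
             (fscal 2 (fmul (fun k => Rabs (y k)) (fun k => Rabs (w k)))))).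
  assert (AA : forall a : fps, fnorm r (fun k => Rabs (a k)) n = fnorm r a n).
  { intros a. apply sum_eq. intros. now rewrite Rabs_Rabsolu. }
  assert (Hd : fnorm r (bb_step mu nu h A B y) n <= fnorm r d n).
  { apply fnorm_le; [exact Hr|]. intros k _. eapply Rle_trans; [|apply Rle_abs].
    assert (P2 : forall j, 0 <= fmul (fun k => Rabs (y k)) (fun k => Rabs (w k)) j).
    { intros j. apply cond_pos_sum. intros; apply Rmult_le_pos; apply Rabs_pos. }
    assert (Hik : 0 < / kappa) by (apply Rinv_0_lt_compat; lra).
    destruct k as [|k].
    - simpl. rewrite Rabs_R0. unfold d, fscal at 1, fadd.
      apply Rmult_le_pos; [lra|]. apply Rplus_le_le_0_compat; [apply Rabs_pos|].
      unfold fscal. specialize (P2 0%nat). lra.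
    - unfold bb_step, bb_rhs. fold w. unfold fsub at 1.
      change (d (S k)) with (/ kappa * (Rabs (fmul fX (A y) (S k))
        + 2 * fmul (fun k => Rabs (y k)) (fun k => Rabs (w k)) (S k))).
      set (a := fmul fX (A y) (S k)). set (e := fmul (fadd y (feuler y)) w (S k)).
      assert (He := Rabs_fmul_euler y w k). fold e in He.
      specialize (P2 (S k)). set (f := fmul (fun k => Rabs (y k)) (fun k => Rabs (w k)) (S k)) in *.
      assert (H1 : 1 <= INR (S k)) by (rewrite S_INR; generalize (pos_INR k); lra).
      assert (HD : 0 < INR (S k) * mu + nu) by nra.
      unfold Rdiv. rewrite Rabs_mult, Rabs_inv, (Rabs_pos_eq (INR (S k) * mu + nu)) by lra.
      apply Rmult_le_reg_r with (INR (S k) * mu + nu); [exact HD|].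
      rewrite Rmult_assoc, Rinv_l, Rmult_1_r by lra.
      assert (Hsub : Rabs (a - e) <= INR (S k) * (Rabs a + 2 * f)).
      { eapply Rle_trans; [apply Rabs_triang|]. rewrite Rabs_Ropp.
        assert (Ha := Rabs_pos a). nra. }
      eapply Rle_trans; [exact Hsub|].
      assert (Ha := Rabs_pos a).
      replace (INR (S k) * (Rabs a + 2 * f))
        with ((/ kappa * (Rabs a + 2 * f)) * (INR (S k) * kappa)) by (field; lra).
      apply Rmult_le_compat_l;
        [|assert (INR (S k) * kappa <= INR (S k) * mu) by (apply Rmult_le_compat_l; lra); lra].
      apply Rmult_le_pos; lra. }
  eapply Rle_trans; [exact Hd|]. unfold d. rewrite fnorm_scal, Rabs_pos_eq
    by (apply Rlt_le, Rinv_0_lt_compat; lra).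
  apply Rmult_le_compat_l; [apply Rlt_le, Rinv_0_lt_compat; lra|].
  eapply Rle_trans; [apply fnorm_add; exact Hr|]. rewrite AA, fnorm_scal, (Rabs_pos_eq 2) by lra.
  apply Rplus_le_compat; [now apply fnorm_X_mul|].
  rewrite Rmult_assoc. apply Rmult_le_compat_l; [lra|].
  eapply Rle_trans; [apply fnorm_mul; exact Hr|]. rewrite !AA.
  apply Rmult_le_compat_l; [now apply fnorm_nonneg|].
  eapply Rle_trans; [apply fnorm_add; exact Hr|]. rewrite fnorm_scal.
  apply Rplus_le_compat_l. now apply fnorm_X_mul.
Qed.

Section BriotBouquetFamily.
Context {U : UniformSpace}.
Variables (p : U) (mu nu h : U -> R) (A B : U -> fps -> fps).
Hypotheses (cmu : continuous mu p) (cnu : continuous nu p) (ch : continuous h p).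
Hypotheses (tA : tame p A) (tB : tame p B) (mu_pos : 0 < mu p) (nu_pos : 0 < nu p).

Lemma bb_iter_continuous k :
  continuous_coefs (fun q => bb_iter (mu q) (nu q) (h q) (A q) (B q) k) p.
Proof.
  induction k as [|k IH]; intros n; simpl.
  - apply continuous_const.
  - destruct n as [|n]; [apply continuous_const|]. unfold bb_step.
    apply continuous_Rdiv.
    + unfold bb_rhs, fsub. apply continuous_Rminus.
      * apply (continuous_coefs_mul (fun _ => fX)); [apply continuous_coefs_fixed|].
        now apply tA.
      * apply (continuous_coefs_mul
          (fun q => fadd (bb_iter (mu q) (nu q) (h q) (A q) (B q) k)
             (feuler (bb_iter (mu q) (nu q) (h q) (A q) (B q) k)))).
        -- intros j. unfold fadd, feuler. apply continuous_Rplus; [apply IH|].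
           apply continuous_Rmult; [apply continuous_const | apply IH].
        -- intros j. unfold fadd. apply continuous_Rplus.
           ++ apply continuous_Rmult; [exact ch | apply IH].
           ++ apply (continuous_coefs_mul (fun _ => fX)); [apply continuous_coefs_fixed|].
              now apply tB.
    + apply continuous_Rplus; [|exact cnu].
      apply continuous_Rmult; [apply continuous_const | exact cmu].
    + apply Rgt_not_eq. now apply bb_denom_pos.
Qed.

Lemma bb_sol_continuous : continuous_coefs (fun q => bb_sol (mu q) (nu q) (h q) (A q) (B q)) p.
Proof. intros n. apply bb_iter_continuous. Qed.

Lemma bb_sol_locally_bounded :
  exists r, 0 < r <= 1 /\
    locally p (fun q => forall n, fnorm r (bb_sol (mu q) (nu q) (h q) (A q) (B q)) n <= 1).
Proof.
  destruct tA as (cA & (MA & HA) & _), tB as (cB & (MB & HB) & _).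
  (* Half of [mu p] is still a lower bound for [mu q] when q is close to p. *)
  set (kappa := mu p / 2). assert (Hk : 0 < kappa) by (unfold kappa; lra).
  set (H := Rabs (h p) + 1). assert (HH : 1 <= H) by (unfold H; generalize (Rabs_pos (h p)); lra).
  (* Radius of a ball that the step maps into itself. It is at most 1, where the tame bounds apply,
     and makes the contribution of h at most [kappa / 8]. *)
  set (rho := Rmin 1 (kappa / (8 * H))).
  assert (Hrho : 0 < rho) by (apply Rmin_pos; [lra|]; apply Rdiv_lt_0_compat; nra).
  assert (Hrho1 : rho <= 1) by apply Rmin_l.
  assert (Hrho2 : 8 * H * rho <= kappa).
  { apply Rle_trans with (8 * H * (kappa / (8 * H))).
    - apply Rmult_le_compat_l; [lra | apply Rmin_r].
    - right. field. lra. }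
  set (NA := Rmax 1 MA). set (NB := Rmax 1 MB).
  assert (HNA : 1 <= NA) by apply Rmax_l. assert (HNB : 1 <= NB) by apply Rmax_l.
  (* With [rho] fixed, r is taken small enough for the [A] term to use half of the budget
     [kappa * rho]. The other half is the quadratic term, 2 [rho] ([kappa / 8] + [kappa / 8]). *)
  set (r := Rmin 1 (Rmin (kappa * rho / (2 * NA)) (kappa / (8 * NB)))).
  assert (Hr : 0 < r).
  { repeat apply Rmin_pos; [lra | |]; apply Rdiv_lt_0_compat; nra. }
  assert (Hr1 : r <= 1) by apply Rmin_l.
  assert (HrA : r * NA <= kappa * rho / 2).
  { apply Rle_trans with (kappa * rho / (2 * NA) * NA).
    - apply Rmult_le_compat_r; [lra|]. eapply Rle_trans; [apply Rmin_r | apply Rmin_l].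
    - right. field. lra. }
  assert (HrB : r * NB <= kappa / 8).
  { apply Rle_trans with (kappa / (8 * NB) * NB).
    - apply Rmult_le_compat_r; [lra|]. eapply Rle_trans; [apply Rmin_r | apply Rmin_r].
    - right. field. lra. }
  exists r. split; [lra|].
  generalize (filter_and (F := locally p) _ _ HA (filter_and (F := locally p) _ _ HB
    (filter_and (F := locally p) _ _
      (continuous_locally_gt mu p kappa cmu ltac:(unfold kappa; lra))
      (filter_and (F := locally p) _ _ (continuous_locally_gt nu p 0 cnu nu_pos)
        (continuous_locally_abs_le h p ch))))).
  apply filter_imp. intros q (qA & qB & qmu & qnu & qh) n. fold H in qh.
  apply Rle_trans with rho; [|exact Hrho1].
  assert (It : forall k, fnorm r (bb_iter (mu q) (nu q) (h q) (A q) (B q) k) n <= rho).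
  { induction k as [|k IH].
    - simpl. rewrite fnorm_const, Rabs_R0. lra.
    - simpl. set (y := bb_iter (mu q) (nu q) (h q) (A q) (B q) k) in *.
      eapply Rle_trans.
      { apply (bb_step_norm _ _ _ _ _ kappa); [split; lra | exact qnu | lra]. }
      assert (BA : fnorm r (A q y) n <= NA).
      { eapply Rle_trans; [apply qA; lra | apply Rmax_r]. }
      assert (BB : fnorm r (B q y) n <= NB).
      { eapply Rle_trans; [apply qB; lra | apply Rmax_r]. }
      assert (Py := fnorm_nonneg r y n ltac:(lra)).
      assert (PB := fnorm_nonneg r (B q y) n ltac:(lra)).
      apply Rmult_le_reg_l with kappa; [exact Hk|].
      rewrite <- Rmult_assoc, Rinv_r, Rmult_1_l by lra.
      assert (E1 : r * fnorm r (A q y) n <= kappa * rho / 2).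
      { eapply Rle_trans; [apply Rmult_le_compat_l; [lra | exact BA] | exact HrA]. }
      assert (E2 : Rabs (h q) * fnorm r y n <= H * rho).
      { apply Rmult_le_compat; auto. apply Rabs_pos. }
      assert (E3 : r * fnorm r (B q y) n <= kappa / 8).
      { eapply Rle_trans; [apply Rmult_le_compat_l; [lra | exact BB] | exact HrB]. }
      assert (E4 : 2 * fnorm r y n * (Rabs (h q) * fnorm r y n + r * fnorm r (B q y) n)
                   <= 2 * rho * (kappa / 4)).
      { apply Rmult_le_compat; try lra.
        apply Rplus_le_le_0_compat; apply Rmult_le_pos; try lra. apply Rabs_pos. }
      lra. }
  (* Up to order n the solution coincides with the n-th iterate, so the bound passes to it without a
     limit. *)
  eapply Rle_trans; [|apply (It n)]. right. apply sum_eq. intros i Hi.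
  rewrite (bb_sol_iter _ _ _ _ _ (cA q) (cB q) i n) by lia. reflexivity.
Qed.
End BriotBouquetFamily.

(** * Evaluation of power series *)

Definition abs_conv (r : R) (a : fps) : Prop := exists M, forall n, fnorm r a n <= M.

Lemma abs_conv_radius r a : 0 <= r -> abs_conv r a -> Rbar_le r (CV_radius a).
Proof.
  intros Hr [M HM]. apply (proj1 (CV_radius_bounded a)). exists M. intros n.
  rewrite Rabs_mult, (Rabs_pos_eq (r ^ n)) by now apply pow_le.
  eapply Rle_trans; [apply fnorm_ge_term; [exact Hr | apply le_n] | apply HM].
Qed.

Lemma abs_conv_lt_radius r a x : abs_conv r a -> Rabs x < r -> Rbar_lt (Rabs x) (CV_radius a).
Proof.
  intros Ha Hx. apply Rbar_lt_le_trans with r; [exact Hx|].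
  apply abs_conv_radius; [generalize (Rabs_pos x); lra | exact Ha].
Qed.

Lemma abs_conv_inside r a : 0 <= r -> Rbar_lt r (CV_radius a) -> abs_conv r a.
Proof.
  intros Hr H. assert (E := CV_disk_inside a r). rewrite Rabs_pos_eq in E by exact Hr.
  specialize (E H). exists (Series (fun n => Rabs (a n * r ^ n))). intros n.
  assert (L : is_lim_seq (sum_n (fun n => Rabs (a n * r ^ n)))
                (Series (fun n => Rabs (a n * r ^ n)))) by exact (Series_correct _ E).
  replace (fnorm r a n) with (sum_n (fun n => Rabs (a n * r ^ n)) n).
  - apply (is_lim_seq_incr_compare _ _ L). intros k. rewrite sum_Sn.
    generalize (Rabs_pos (a (S k) * r ^ S k)). unfold plus; simpl; lra.
  - rewrite sum_n_Reals. apply sum_eq. intros i _.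
    rewrite Rabs_mult, (Rabs_pos_eq (r ^ i)) by now apply pow_le. reflexivity.
Qed.

Lemma abs_conv_mul r a b : 0 <= r -> abs_conv r a -> abs_conv r b -> abs_conv r (fmul a b).
Proof.
  intros Hr [M HM] [N HN]. exists (M * N). intros n.
  eapply Rle_trans; [now apply fnorm_mul|].
  apply Rmult_le_compat; auto; now apply fnorm_nonneg.
Qed.

Lemma abs_conv_add r a b : 0 <= r -> abs_conv r a -> abs_conv r b -> abs_conv r (fadd a b).
Proof.
  intros Hr [M HM] [N HN]. exists (M + N). intros n.
  eapply Rle_trans; [now apply fnorm_add | now apply Rplus_le_compat].
Qed.

Lemma abs_conv_sub r a b : 0 <= r -> abs_conv r a -> abs_conv r b -> abs_conv r (fsub a b).
Proof.
  intros Hr [M HM] [N HN]. exists (M + N). intros n.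
  eapply Rle_trans; [now apply fnorm_sub | now apply Rplus_le_compat].
Qed.

Lemma abs_conv_const r k : abs_conv r (fconst k).
Proof. exists (Rabs k). intros n. rewrite fnorm_const. lra. Qed.

Lemma abs_conv_scal r k a : 0 <= r -> abs_conv r a -> abs_conv r (fscal k a).
Proof. intros. rewrite fscal_fconst. apply abs_conv_mul; auto using abs_conv_const. Qed.

Lemma abs_conv_X r : 0 <= r -> abs_conv r fX.
Proof. intros. exists r. intros; now apply fX_norm. Qed.

(** Keeping summability together with the values lets identities between formal series and between
    functions be exchanged, one ring operation at a time. *)
Definition evals (r : R) (a : fps) (f : R -> R) : Prop :=
  abs_conv r a /\ forall x, Rabs x < r -> PSeries a x = f x.

Lemma evals_PSeries r a : abs_conv r a -> evals r a (PSeries a).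
Proof. intros; split; auto. Qed.

Lemma PSeries_fconst k x : PSeries (fconst k) x = k.
Proof.
  apply is_pseries_unique, is_pseries_R. unfold is_series.
  apply filterlim_ext with (fun _ => k); [|apply filterlim_const].
  intros n. rewrite sum_n_Reals. induction n as [|n IH]; simpl.
  - ring.
  - rewrite <- IH. ring.
Qed.

Lemma PSeries_fX x : PSeries fX x = x.
Proof.
  rewrite PSeries_decr_1_aux by reflexivity.
  rewrite (PSeries_ext _ (fconst 1)), PSeries_fconst; [ring|].
  intros [|n]; reflexivity.
Qed.

Lemma evals_const r k : evals r (fconst k) (fun _ => k).
Proof. split; [apply abs_conv_const | intros; apply PSeries_fconst]. Qed.

Lemma evals_X r : 0 <= r -> evals r fX (fun x => x).
Proof. split; [now apply abs_conv_X | intros; apply PSeries_fX]. Qed.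

Lemma evals_ex r a f x : evals r a f -> Rabs x < r -> ex_pseries a x.
Proof. intros [H _] Hx. apply CV_radius_inside. now apply (abs_conv_lt_radius r). Qed.

Lemma evals_add r a b f k : 0 <= r ->
  evals r a f -> evals r b k -> evals r (fadd a b) (fun x => f x + k x).
Proof.
  intros Hr Ha Hb. split; [apply abs_conv_add; [exact Hr | apply Ha | apply Hb]|].
  intros x Hx. rewrite <- (proj2 Ha x Hx), <- (proj2 Hb x Hx).
  apply PSeries_plus; eapply evals_ex; eauto.
Qed.

Lemma evals_sub r a b f k : 0 <= r ->
  evals r a f -> evals r b k -> evals r (fsub a b) (fun x => f x - k x).
Proof.
  intros Hr Ha Hb. split; [apply abs_conv_sub; [exact Hr | apply Ha | apply Hb]|].
  intros x Hx. rewrite <- (proj2 Ha x Hx), <- (proj2 Hb x Hx).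
  apply PSeries_minus; eapply evals_ex; eauto.
Qed.

Lemma evals_scal r c a f : 0 <= r -> evals r a f -> evals r (fscal c a) (fun x => c * f x).
Proof.
  intros Hr Ha. split; [apply abs_conv_scal; [exact Hr | apply Ha]|].
  intros x Hx. rewrite <- (proj2 Ha x Hx). apply PSeries_scal.
Qed.

Lemma evals_mul r a b f k : 0 <= r ->
  evals r a f -> evals r b k -> evals r (fmul a b) (fun x => f x * k x).
Proof.
  intros Hr Ha Hb. split; [apply abs_conv_mul; [exact Hr | apply Ha | apply Hb]|].
  intros x Hx. rewrite <- (proj2 Ha x Hx), <- (proj2 Hb x Hx).
  apply PSeries_mult; eapply abs_conv_lt_radius; eauto; [apply Ha | apply Hb].
Qed.

Lemma evals_ext r a f k : evals r a f -> (forall x, Rabs x < r -> f x = k x) -> evals r a k.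
Proof. intros [H1 H2] H. split; [exact H1|]. intros x Hx. now rewrite H2, H. Qed.

Lemma evals_unique r a b f : 0 < r -> evals r a f -> evals r b f -> a = b.
Proof.
  intros Hr [Ha Fa] [Hb Fb]. extensionality n. apply PSeries_ext_recip.
  - rewrite <- Rabs_R0. apply (abs_conv_lt_radius r); [exact Ha | now rewrite Rabs_R0].
  - rewrite <- Rabs_R0. apply (abs_conv_lt_radius r); [exact Hb | now rewrite Rabs_R0].
  - exists (mkposreal r Hr). intros x Hx.
    assert (Rabs x < r).
    { replace x with (x - 0) by ring. exact Hx. }
    now rewrite Fa, Fb.
Qed.

(** Bounded partial sums at r control the differentiated series only strictly inside, hence the
    smaller radius s. *)
Lemma evals_derive r s a f : 0 <= s < r -> evals r a f -> evals s (fderiv a) (Derive f).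
Proof.
  intros Hs [Ha Fa]. split.
  - apply abs_conv_inside; [lra|]. change (fderiv a) with (PS_derive a).
    rewrite CV_radius_derive. rewrite <- (Rabs_pos_eq s) by lra.
    apply (abs_conv_lt_radius r); [exact Ha | rewrite Rabs_pos_eq; lra].
  - intros x Hx. change (fderiv a) with (PS_derive a).
    rewrite <- Derive_PSeries by (apply (abs_conv_lt_radius r); [exact Ha | lra]).
    apply Derive_ext_loc. assert (Hp : 0 < s - Rabs x) by lra.
    exists (mkposreal _ Hp). intros y Hy. apply Fa.
    assert (Hy' : Rabs (y - x) < s - Rabs x) by exact Hy.
    replace y with ((y - x) + x) by ring.
    eapply Rle_lt_trans; [apply Rabs_triang | lra].
Qed.

Section EvaluateField.
Variables (m g z Vs r : R) (c : fps) (f : R -> R).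
Hypotheses (r_pos : 0 < r) (Hc : evals r c f).
Let v := fadd (fconst Vs) fX.

Lemma evals_v s : 0 <= s -> evals s v (fun x => Vs + x).
Proof. intros. apply evals_add; auto using evals_const, evals_X. Qed.

Lemma evals_fG : evals r (fG m g z v c) (fun x => Gf m g z (Vs + x) (f x)).
Proof.
  assert (Hr : 0 <= r) by lra. assert (Hv := evals_v r Hr).
  eapply evals_ext.
  - unfold fG. repeat first [exact Hc | exact Hv | apply evals_const | apply evals_sub; [exact Hr| |]
      | apply evals_mul; [exact Hr| |] | apply evals_add; [exact Hr| |] | apply evals_scal; [exact Hr|]].
  - intros x _. unfold Gf. simpl. ring.
Qed.

Lemma evals_fFhat : evals r (fFhat m g z v c) (fun x => Fhat m g z (Vs + x) (f x)).
Proof.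
  assert (Hr : 0 <= r) by lra. assert (Hv := evals_v r Hr).
  eapply evals_ext.
  - unfold fFhat. repeat first [exact Hc | exact Hv | apply evals_const | apply evals_sub; [exact Hr| |]
      | apply evals_mul; [exact Hr| |] | apply evals_add; [exact Hr| |] | apply evals_scal; [exact Hr|]].
  - intros x _. unfold Fhat. simpl. ring.
Qed.

Lemma evals_ode_rhs s : 0 <= s < r ->
  evals s (fmul (fadd (fconst 1) v) (fmul (fderiv c) (fG m g z v c)))
    (fun x => (1 + (Vs + x)) * (Derive f x * Gf m g z (Vs + x) (f x))).
Proof.
  intros Hs. assert (Hs0 : 0 <= s) by lra.
  apply evals_mul; [exact Hs0| |].
  - apply evals_add; auto using evals_const, evals_v.
  - apply evals_mul; [exact Hs0| |].
    + now apply (evals_derive r).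
    + split; [|intros x Hx; apply (proj2 evals_fG); lra].
      destruct evals_fG as [H _]. apply abs_conv_inside; [exact Hs0|].
      rewrite <- (Rabs_pos_eq s) by lra.
      apply (abs_conv_lt_radius r); [exact H | rewrite Rabs_pos_eq; lra].
Qed.

Lemma evals_restrict s a h : 0 <= s < r -> evals r a h -> evals s a h.
Proof.
  intros Hs [H1 H2]. split; [|intros; apply H2; lra].
  apply abs_conv_inside; [lra|]. rewrite <- (Rabs_pos_eq s) by lra.
  apply (abs_conv_lt_radius r); [exact H1 | rewrite Rabs_pos_eq; lra].
Qed.

Lemma formal_sol_ode x : formal_sol m g z Vs c -> Rabs x < r -> 1 + (Vs + x) <> 0 ->
  Derive f x * Gf m g z (Vs + x) (f x) = Ff m g z (Vs + x) (f x).
Proof.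
  intros H Hx Hne. assert (Hp := Rabs_pos x).
  apply Rmult_eq_reg_l with (1 + (Vs + x)); [|exact Hne].
  rewrite Fhat_spec by exact Hne.
  (* A radius strictly between |x| and r pays for the loss in the derivative. *)
  assert (Hs : 0 <= (Rabs x + r) / 2 < r) by lra.
  rewrite <- (proj2 (evals_ode_rhs _ Hs) x) by lra.
  rewrite <- (proj2 evals_fFhat x Hx). apply PSeries_ext. intros n. symmetry. apply H.
Qed.

Lemma ode_formal_sol :
  (forall x, Rabs x < r -> Derive f x * Gf m g z (Vs + x) (f x) = Ff m g z (Vs + x) (f x)) ->
  (forall x, Rabs x < r -> 1 + (Vs + x) <> 0) ->
  formal_sol m g z Vs c.
Proof.
  intros H Hne. assert (Hs : 0 <= r / 2 < r) by lra.
  assert (E : fFhat m g z v c = fmul (fadd (fconst 1) v) (fmul (fderiv c) (fG m g z v c))).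
  { apply (evals_unique (r / 2)) with (fun x => Fhat m g z (Vs + x) (f x)); [lra| |].
    - now apply evals_restrict, evals_fFhat.
    - eapply evals_ext; [now apply evals_ode_rhs|].
      intros x Hx. cbv beta. rewrite H by lra. apply Fhat_spec, Hne. lra. }
  intros n. exact (f_equal (fun a => a n) E).
Qed.
End EvaluateField.

(** * Re-expansion of power series *)

Lemma series_nonneg_bounded (a : nat -> R) M :
  (forall n, 0 <= a n) -> (forall n, sum_f_R0 a n <= M) -> ex_series a /\ Series a <= M.
Proof.
  intros Ha HM.
  assert (E : ex_series a).
  { destruct (ex_finite_lim_seq_incr (sum_n a) M) as [l Hl].
    - intros n. rewrite sum_Sn. specialize (Ha (S n)). unfold plus; simpl; lra.
    - intros n. rewrite sum_n_Reals. apply HM.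
    - exists l. exact Hl. }
  split; [exact E|].
  assert (L : is_lim_seq (sum_n a) (Series a)) by exact (Series_correct _ E).
  apply (is_lim_seq_le (sum_n a) (fun _ => M) (Series a) M); [|exact L|apply is_lim_seq_const].
  intros n. rewrite sum_n_Reals. apply HM.
Qed.

Lemma fnorm_shift r a k n : 0 <= r ->
  sum_f_R0 (fun i => Rabs (a (i + k)%nat) * r ^ (i + k)) n <= fnorm r a (n + k).
Proof.
  intros Hr. induction n as [|n IH].
  - simpl. apply fnorm_ge_term; [exact Hr | lia].
  - simpl sum_f_R0. replace (S n + k)%nat with (S (n + k)) by lia.
    rewrite fnorm_S. simpl pow. lra.
Qed.

(** The left side is k! times a single term of the binomial expansion of (x + y)^(n+k), whose terms
    are all nonnegative. *)
Lemma binomial_coef_le x y k n : 0 <= x -> 0 <= y ->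
  INR (Factorial.fact (n + k)) / INR (Factorial.fact n) * x ^ n * y ^ k <= INR (Factorial.fact k) * (x + y) ^ (n + k).
Proof.
  intros Hx Hy. rewrite binomial.
  assert (Hk := INR_fact_lt_0 k). assert (Hn := INR_fact_lt_0 n).
  set (t := fun i => Binomial.C (n + k) i * x ^ i * y ^ (n + k - i)).
  assert (Pt : forall i, 0 <= t i).
  { intros i. unfold t, Binomial.C. repeat apply Rmult_le_pos; try (now apply pow_le); try apply pos_INR.
    apply Rlt_le, Rinv_0_lt_compat, Rmult_lt_0_compat; apply INR_fact_lt_0. }
  assert (Lt : forall N, (n <= N)%nat -> t n <= sum_f_R0 t N).
  { induction N as [|N IH]; intros HN.
    - assert (n = 0)%nat by lia; subst. simpl; lra.
    - simpl. destruct (Nat.eq_dec n (S N)) as [->|].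
      + generalize (cond_pos_sum t N Pt). lra.
      + specialize (IH ltac:(lia)). specialize (Pt (S N)). lra. }
  specialize (Lt (n + k)%nat ltac:(lia)).
  apply Rle_trans with (INR (Factorial.fact k) * t n).
  - right. unfold t, Binomial.C. replace (n + k - n)%nat with k by lia. field. lra.
  - apply Rmult_le_compat_l; lra.
Qed.

(** A Cauchy estimate obtained without complex analysis: termwise, the binomial inequality compares
    the differentiated series at x with the original one at |x| + s. *)
Lemma derive_n_bound r s a M k x :
  0 < s -> Rabs x + s <= r -> (forall n, fnorm r a n <= M) ->
  Rabs (PSeries (PS_derive_n k a) x) <= INR (Factorial.fact k) * (M / s ^ k).
Proof.
  intros Hs Hx HM. assert (Hk := INR_fact_lt_0 k). assert (Hx0 := Rabs_pos x).
  assert (Hsk : 0 < s ^ k) by now apply pow_lt.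
  assert (Hr : 0 <= r) by lra.
  destruct (series_nonneg_bounded (fun n => Rabs (PS_derive_n k a n * x ^ n))
             (INR (Factorial.fact k) * (M / s ^ k))) as [E L].
  - intros; apply Rabs_pos.
  - intros N. apply Rle_trans with
      (sum_f_R0 (fun i => (Rabs (a (i + k)%nat) * r ^ (i + k)) * (INR (Factorial.fact k) / s ^ k)) N).
    + apply sum_Rle. intros n _. unfold PS_derive_n.
      rewrite !Rabs_mult, <- RPow_abs.
      assert (Hn := INR_fact_lt_0 n). assert (Hnk := INR_fact_lt_0 (n + k)).
      rewrite (Rabs_pos_eq (INR (Factorial.fact (n + k)) / INR (Factorial.fact n)))
        by (apply Rlt_le, Rdiv_lt_0_compat; assumption).
      assert (B := binomial_coef_le (Rabs x) s k n Hx0 (Rlt_le _ _ Hs)).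
      assert (P : (Rabs x + s) ^ (n + k) <= r ^ (n + k)) by (apply pow_incr; lra).
      replace (INR (Factorial.fact (n + k)) / INR (Factorial.fact n) * Rabs (a (n + k)%nat) * Rabs x ^ n)
        with (Rabs (a (n + k)%nat) * (INR (Factorial.fact (n + k)) / INR (Factorial.fact n) * Rabs x ^ n * s ^ k) / s ^ k)
        by (field; lra).
      replace (Rabs (a (n + k)%nat) * r ^ (n + k) * (INR (Factorial.fact k) / s ^ k))
        with (Rabs (a (n + k)%nat) * (INR (Factorial.fact k) * r ^ (n + k)) / s ^ k) by (field; lra).
      apply Rmult_le_compat_r; [apply Rlt_le, Rinv_0_lt_compat; exact Hsk|].
      apply Rmult_le_compat_l; [apply Rabs_pos|].
      eapply Rle_trans; [exact B|]. apply Rmult_le_compat_l; lra.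
    + rewrite <- scal_sum.
      replace (INR (Factorial.fact k) * (M / s ^ k)) with (INR (Factorial.fact k) / s ^ k * M) by (field; lra).
      apply Rmult_le_compat_l; [apply Rlt_le, Rdiv_lt_0_compat; assumption|].
      eapply Rle_trans; [now apply fnorm_shift | apply HM].
  - eapply Rle_trans; [|exact L]. now apply Series_Rabs.
Qed.

Definition taylor_coef (a : fps) (x0 : R) : fps :=
  fun k => PSeries (PS_derive_n k a) x0 / INR (Factorial.fact k).

(** Lagrange's remainder at an intermediate point, where the Cauchy estimate cancels the
    factorial. *)
Lemma taylor_remainder_right r s a M x0 h n :
  0 < h -> 0 < s -> Rabs x0 + h + s <= r -> (forall n, fnorm r a n <= M) ->
  Rabs (PSeries a (x0 + h) - sum_f_R0 (fun k => taylor_coef a x0 k * h ^ k) n) <= M * (h / s) ^ S n.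
Proof.
  intros Hh Hs Hr HM.
  assert (Hin : forall t, x0 <= t <= x0 + h -> Rabs t + s <= r).
  { intros t Ht. replace t with (x0 + (t - x0)) by ring.
    assert (Rabs (x0 + (t - x0)) <= Rabs x0 + h); [|lra].
    eapply Rle_trans; [apply Rabs_triang|]. rewrite (Rabs_pos_eq (t - x0)); lra. }
  assert (Hrad : forall t, x0 <= t <= x0 + h -> Rbar_lt (Rabs t) (CV_radius a)).
  { intros t Ht. apply (abs_conv_lt_radius r); [now exists M|]. specialize (Hin t Ht). lra. }
  destruct (Taylor_Lagrange (PSeries a) n x0 (x0 + h)) as (t & Ht & E).
  - lra.
  - intros t Ht k _. now apply ex_derive_n_PSeries, Hrad.
  - rewrite E. replace (x0 + h - x0) with h by ring.
    rewrite Derive_n_PSeries by (apply Hrad; lra).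
    rewrite (sum_eq _ (fun k => taylor_coef a x0 k * h ^ k)).
    2:{ intros k _. rewrite Derive_n_PSeries by (apply Hrad; lra).
        unfold taylor_coef. field. apply INR_fact_neq_0. }
    match goal with |- Rabs (?A + ?B - ?A) <= _ => replace (A + B - A) with B by ring end.
    assert (HF := INR_fact_lt_0 (S n)).
    assert (Hhn : 0 < h ^ S n) by now apply pow_lt.
    assert (Hsn : 0 < s ^ S n) by now apply pow_lt.
    rewrite Rabs_mult, (Rabs_pos_eq (h ^ S n / INR (Factorial.fact (S n))))
      by (apply Rlt_le, Rdiv_lt_0_compat; assumption).
    assert (D := derive_n_bound r s a M (S n) t Hs (Hin t ltac:(lra)) HM).
    eapply Rle_trans.
    { apply Rmult_le_compat_l; [apply Rlt_le, Rdiv_lt_0_compat; assumption | exact D]. }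
    replace ((h / s) ^ S n) with (h ^ S n / s ^ S n)
      by (unfold Rdiv; now rewrite Rpow_mult_distr, pow_inv).
    right. field. lra.
Qed.

(** The coefficients of a(-x): this reflection turns expansion to the left of a point into expansion
    to the right. *)
Definition falt (a : fps) : fps := fun n => (-1) ^ n * a n.

Lemma PSeries_falt a x : PSeries (falt a) (- x) = PSeries a x.
Proof.
  apply Series_ext. intros n. unfold falt.
  replace (- x) with (-1 * x) by ring. rewrite Rpow_mult_distr.
  replace ((-1) ^ n * a n * ((-1) ^ n * x ^ n)) with (((-1) ^ n * (-1) ^ n) * (a n * x ^ n)) by ring.
  rewrite <- Rpow_mult_distr. replace (-1 * -1) with 1 by ring. rewrite pow1. ring.
Qed.

Lemma fnorm_falt r a n : fnorm r (falt a) n = fnorm r a n.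
Proof. apply sum_eq. intros. unfold falt. rewrite Rabs_mult, pow_1_abs. ring. Qed.

Lemma taylor_coef_falt a x k : taylor_coef (falt a) (- x) k = (-1) ^ k * taylor_coef a x k.
Proof.
  unfold taylor_coef, Rdiv. rewrite <- Rmult_assoc. f_equal.
  rewrite <- PSeries_scal, <- (PSeries_falt (PS_scal _ _)). apply PSeries_ext.
  intros n. unfold PS_derive_n, falt, PS_scal, scal; simpl; unfold mult; simpl.
  rewrite pow_add. ring.
Qed.

Lemma taylor_remainder r s a M x0 h n :
  0 < s -> Rabs x0 + Rabs h + s <= r -> (forall n, fnorm r a n <= M) ->
  Rabs (PSeries a (x0 + h) - sum_f_R0 (fun k => taylor_coef a x0 k * h ^ k) n)
  <= M * (Rabs h / s) ^ S n.
Proof.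
  intros Hs Hr HM. destruct (Rtotal_order h 0) as [H|[->|H]].
  - rewrite (Rabs_left h) in * by exact H.
    rewrite <- PSeries_falt, Ropp_plus_distr.
    rewrite (sum_eq _ (fun k => taylor_coef (falt a) (- x0) k * (- h) ^ k)).
    + apply (taylor_remainder_right r); try lra.
      * rewrite Rabs_Ropp. lra.
      * intros k. now rewrite fnorm_falt.
    + intros k _. rewrite taylor_coef_falt.
      replace h with (-1 * - h) at 1 by ring. rewrite Rpow_mult_distr. ring.
  (* For h = 0 the Taylor sum reduces to its term of order 0 and the bound is 0. *)
  - rewrite Rabs_R0. unfold Rdiv. rewrite Rmult_0_l, pow_i, Rmult_0_r by lia.
    right. rewrite Rplus_0_r.
    replace (sum_f_R0 _ n) with (PSeries a x0); [rewrite Rminus_diag; apply Rabs_R0|].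
    induction n as [|n IH].
    + simpl. unfold taylor_coef. simpl. rewrite Rmult_1_r, Rdiv_1_r.
      apply PSeries_ext. intros k. unfold PS_derive_n. rewrite Nat.add_0_r. field.
      apply INR_fact_neq_0.
    + simpl sum_f_R0. rewrite <- IH. simpl. ring.
  - rewrite (Rabs_pos_eq h) in * by lra. now apply (taylor_remainder_right r).
Qed.

Lemma PSeries_reexpand r a x0 : abs_conv r a -> Rabs x0 < r ->
  exists s, 0 < s /\ exists d : nat -> R,
    forall x, Rabs (x - x0) < s -> is_pseries d (x - x0) (PSeries a x).
Proof.
  (* Half the distance to the boundary serves both as the range of h and as the margin in the Cauchy
     estimate, so the remainder is geometric of ratio |h| / s < 1. *)
  intros [M HM] Hx0. set (s := (r - Rabs x0) / 2). exists s.
  assert (Hs : 0 < s) by (unfold s; lra). split; [exact Hs|].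
  exists (taylor_coef a x0). intros x Hx. set (h := x - x0) in *.
  apply is_pseries_R.
  change (is_lim_seq (sum_n (fun n => taylor_coef a x0 n * h ^ n)) (PSeries a x)).
  apply is_lim_seq_spec. intros e.
  assert (Hq0 : 0 <= Rabs h / s)
    by (apply Rmult_le_pos; [apply Rabs_pos | apply Rlt_le, Rinv_0_lt_compat; lra]).
  assert (Hq : Rabs (Rabs h / s) < 1).
  { rewrite Rabs_pos_eq by exact Hq0. apply Rmult_lt_reg_r with s; [exact Hs|].
    unfold Rdiv. rewrite Rmult_assoc, Rinv_l by lra. lra. }
  assert (HM0 : 0 <= M).
  { eapply Rle_trans; [|apply (HM 0%nat)]. apply fnorm_nonneg.
    generalize (Rabs_pos x0); lra. }
  destruct (pow_lt_1_zero _ Hq (e / (M + 1))) as [N HN].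
  { apply Rdiv_lt_0_compat; [apply cond_pos | lra]. }
  exists N. intros n Hn. rewrite sum_n_Reals.
  rewrite Rabs_minus_sym. replace x with (x0 + h) by (unfold h; ring).
  eapply Rle_lt_trans; [apply (taylor_remainder r s); auto; unfold s in *; lra|].
  specialize (HN (S n) ltac:(lia)). rewrite Rabs_pos_eq in HN by now apply pow_le.
  apply Rle_lt_trans with (M * (e / (M + 1))).
  - apply Rmult_le_compat_l; lra.
  - assert (He := cond_pos e). apply Rmult_lt_reg_r with (M + 1); [lra|].
    replace (M * (e / (M + 1)) * (M + 1)) with (M * e) by (field; lra). nra.
Qed.

Lemma abs_conv_analytic r a V0 : abs_conv r a ->
  analytic_on (fun V => PSeries a (V - V0)) (V0 - r) (V0 + r).
Proof.
  intros Ha x0 Hx0. destruct (PSeries_reexpand r a (x0 - V0) Ha) as (s & Hs & d & Hd).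
  { apply Rabs_lt_between. lra. }
  exists s. split; [exact Hs|]. exists d. intros x Hx.
  replace (x - x0) with (x - V0 - (x0 - V0)) in * by ring. now apply Hd.
Qed.

(** * Dominated series and coefficient bounds *)

(** The Weierstrass test: the tail is at most B q^(N+1) / (1 - q) uniformly near p, and the finite
    sum is continuous, so three errors below e / 3 suffice. *)
Lemma Series_continuous {U : UniformSpace} (a : nat -> U -> R) (p : U) B q :
  0 <= q < 1 -> (forall n, continuous (a n) p) ->
  locally p (fun u => forall n, Rabs (a n u) <= B * q ^ n) ->
  continuous (fun u => Series (fun n => a n u)) p.
Proof.
  intros Hq Ha HB.
  assert (HqA : Rabs q < 1) by (rewrite Rabs_pos_eq; lra).
  assert (B0 : 0 <= B).
  { generalize (locally_singleton _ _ HB 0%nat). simpl. generalize (Rabs_pos (a 0%nat p)). lra. }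
  assert (Tail : forall u, (forall n, Rabs (a n u) <= B * q ^ n) -> forall N,
    Rabs (Series (fun n => a n u) - sum_f_R0 (fun n => a n u) N) <= B * q ^ S N / (1 - q)).
  { intros u Hu N.
    assert (Eg : forall M, ex_series (fun n => B * q ^ M * q ^ n)).
    { intros M. apply (ex_series_scal (V := R_NormedModule) (B * q ^ M) (fun n => q ^ n)), ex_series_geom, HqA. }
    assert (Ex : ex_series (fun n => a n u)).
    { apply (ex_series_le (V := R_CompleteNormedModule) _ (fun n => B * q ^ 0 * q ^ n)); [|apply Eg].
      intros n. simpl. rewrite Rmult_1_r. apply Hu. }
    rewrite (Series_incr_n _ (S N)) by (try lia; exact Ex). simpl pred.
    match goal with |- Rabs (?A + ?D - ?A) <= _ => replace (A + D - A) with D by ring end.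
    assert (Hn : forall n, Rabs (a (S N + n)%nat u) <= B * q ^ S N * q ^ n).
    { intros n. rewrite Rmult_assoc, <- pow_add. apply Hu. }
    eapply Rle_trans; [apply Series_Rabs|].
    - apply (ex_series_le (V := R_CompleteNormedModule) _ (fun n => B * q ^ S N * q ^ n)); [|apply Eg].
      intros n. eapply Rle_trans; [|apply Hn]. right. apply Rabs_Rabsolu.
    - eapply Rle_trans; [apply Series_le with (b := fun n => B * q ^ S N * q ^ n)|].
      + intros n. split; [apply Rabs_pos | apply Hn].
      + apply Eg.
      + right. rewrite Series_scal_l, Series_geom by exact HqA. reflexivity. }
  intros P [e He].
  (* Dividing by B + 1 covers B = 0. *)
  destruct (pow_lt_1_zero q HqA (e / 3 * (1 - q) / (B + 1))) as [N HN].
  { apply Rdiv_lt_0_compat; [|lra]. apply Rmult_lt_0_compat; [|lra].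
    generalize (cond_pos e); lra. }
  assert (Hsmall : B * q ^ S N / (1 - q) < e / 3).
  { specialize (HN (S N) ltac:(lia)). rewrite Rabs_pos_eq in HN by (apply pow_le; lra).
    assert (Hc : 0 < e / 3 * (1 - q)) by (generalize (cond_pos e); nra).
    apply Rmult_lt_reg_r with (1 - q); [lra|].
    replace (B * q ^ S N / (1 - q) * (1 - q)) with (B * q ^ S N) by (field; lra).
    apply Rle_lt_trans with (B * (e / 3 * (1 - q) / (B + 1))).
    - apply Rmult_le_compat_l; lra.
    - apply Rmult_lt_reg_r with (B + 1); [lra|].
      replace (B * (e / 3 * (1 - q) / (B + 1)) * (B + 1)) with (B * (e / 3 * (1 - q))) by (field; lra).
      nra. }
  assert (He3 : 0 < e / 3) by (generalize (cond_pos e); lra).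
  assert (Cs := continuous_eps _ p (continuous_sum_f_R0 a p N (fun i _ => Ha i)) (e / 3) He3).
  assert (Tp := Tail p (locally_singleton _ _ HB) N).
  unfold filtermap.
  generalize (filter_and (F := locally p) _ _ Cs HB). apply filter_imp.
  intros u [Hu1 Hu2]. apply He.
  assert (Tu := Tail u Hu2 N).
  change (Rabs (Series (fun n => a n u) - Series (fun n => a n p)) < e).
  set (Su := Series (fun n => a n u)) in *. set (Sp := Series (fun n => a n p)) in *.
  set (su := sum_f_R0 (fun n => a n u) N) in *. set (sp := sum_f_R0 (fun n => a n p) N) in *.
  replace (Su - Sp) with ((Su - su) + (su - sp) - (Sp - sp)) by ring.
  eapply Rle_lt_trans; [apply Rabs_triang|]. rewrite Rabs_Ropp.
  generalize (Rabs_triang (Su - su) (su - sp)). lra.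
Qed.

Lemma geometric_to_power_bound (c : nat -> R) A Q alpha :
  1 <= A -> 1 <= Q -> (forall l, Rabs (c l) <= A * Q ^ l) -> 1 < alpha < 2 ->
  exists K, 1 < K /\
    forall l, (2 <= l)%nat -> Rabs (c l) <= Rpower K (INR l - alpha) / INR l ^ 3.
Proof.
  intros HA HQ Hc Halpha.
  (* Since l - alpha >= l (1 - alpha / 2) for l >= 2 and l ^ 3 <= 8 ^ l, it is enough that K ^ (1 - alpha / 2) = 8 A Q. *)
  set (T := 8 * A * Q). assert (HT : 8 <= T) by (unfold T; nra).
  set (b := / (1 - alpha / 2)).
  assert (Hb : 0 < b) by (apply Rinv_0_lt_compat; lra).
  exists (Rpower T b).
  assert (HK : 1 < Rpower T b).
  { rewrite <- (Rpower_O T) by lra. apply Rpower_lt; lra. }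
  split; [exact HK|]. intros l Hl.
  assert (Hl2 : 2 <= INR l) by (apply (le_INR 2); exact Hl).
  assert (Hl3 : 0 < INR l ^ 3) by (apply pow_lt; lra).
  apply Rmult_le_reg_r with (INR l ^ 3); [exact Hl3|].
  unfold Rdiv. rewrite Rmult_assoc, Rinv_l, Rmult_1_r by lra.
  apply Rle_trans with (T ^ l).
  - assert (Hll : INR l <= 2 ^ l).
    { clear. induction l as [|l IH]; [simpl; lra|]. rewrite S_INR. simpl.
      assert (1 <= 2 ^ l) by (apply pow_R1_Rle; lra). lra. }
    assert (H8 : INR l ^ 3 <= 8 ^ l).
    { replace 8 with (2 ^ 3) by ring. rewrite <- pow_mult, Nat.mul_comm, pow_mult.
      apply pow_incr. lra. }
    unfold T. rewrite !Rpow_mult_distr.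
    assert (HAl : A <= A ^ l).
    { destruct l as [|l]; [lia|]. simpl. assert (1 <= A ^ l) by now apply pow_R1_Rle. nra. }
    assert (HQl : 1 <= Q ^ l) by now apply pow_R1_Rle.
    apply Rle_trans with (A * Q ^ l * 8 ^ l).
    + apply Rmult_le_compat; [apply Rabs_pos | lra | apply Hc | exact H8].
    + assert (P8 : 1 <= 8 ^ l) by (apply pow_R1_Rle; lra).
      assert (0 < Q ^ l * 8 ^ l) by nra. nra.
  - rewrite <- Rpower_pow by lra. rewrite Rpower_mult. apply Rle_Rpower; [lra|].
    apply Rmult_le_reg_l with (1 - alpha / 2); [lra|].
    rewrite <- Rmult_assoc. unfold b. rewrite Rinv_r by lra. nra.
Qed.

(** * The critical point *)

(** This and the next three are the partial derivatives on the line C = 1 + V, cleared of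
    denominators. In [fC] the relation F = 0 has also been used to eliminate [a3]. *)
Definition gV (m g z V : R) : R :=
  (m + 1) * ((1 + V) * (1 + V))
  - ((1 + V) * (lam m g z + V) + V * (lam m g z + V) + V * (1 + V)).
Definition gC (m z V : R) : R := 2 * ((1 + V) * ((m + 1) * V + 2 * (m * z))).
Definition fV (m g z V : R) : R := (1 + V) * (a2 m g z - m * z - 2 * (a1 m g * (1 + V))).
Definition fC (m z V : R) : R := 2 * ((1 + V) * (1 + V + m * z)).

Section CriticalPoint.
Variables (m : R) (br : branch) (g z : R).
Hypothesis Had : admissible m br g z.

Let w := wf g z.
Let V := Vstar br g z.

Lemma admissible_z_pos : 0 < z.
Proof.
  destruct Had as (_ & Hg & Hz). destruct br; [|lra].
  apply Rlt_le_trans with (zm g); [|lra]. unfold zm.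
  apply Rdiv_lt_0_compat; nra.
Qed.

Lemma admissible_zM : z * (sqrt g + sqrt 2) ^ 2 <= 1.
Proof.
  destruct Had as (_ & Hg & Hz).
  assert (H : z <= zM g) by (destruct br; lra). unfold zM in H.
  assert (P : 0 < (sqrt g + sqrt 2) ^ 2).
  { apply pow_lt. generalize (sqrt_lt_R0 g) (sqrt_lt_R0 2). lra. }
  apply Rmult_le_reg_r with (/ (sqrt g + sqrt 2) ^ 2); [now apply Rinv_0_lt_compat|].
  rewrite Rmult_assoc, Rinv_r by lra. lra.
Qed.

(** For g <= 3 the number (sqrt g + sqrt 2)^2 = g + 2 + 2 sqrt (2 g) exceeds 2 g. This rational
    consequence of z <= z_M feeds the sign estimates. *)
Lemma admissible_two_gz : 2 * g * z < 1.
Proof.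
  assert (Hz := admissible_z_pos). assert (H := admissible_zM).
  destruct Had as (_ & Hg & _).
  assert (S1 : sqrt g * sqrt g = g) by (apply sqrt_sqrt; lra).
  assert (S2 : sqrt 2 * sqrt 2 = 2) by (apply sqrt_sqrt; lra).
  assert (L1 : 1 <= sqrt g) by (rewrite <- sqrt_1; apply sqrt_le_1; lra).
  assert (L2 : 1 <= sqrt 2) by (rewrite <- sqrt_1; apply sqrt_le_1; lra).
  assert (P : 2 * g < (sqrt g + sqrt 2) ^ 2) by nra.
  apply Rlt_le_trans with (z * (sqrt g + sqrt 2) ^ 2); [|exact H]. nra.
Qed.

(** With s = sqrt g and t = sqrt 2 the radicand factors as (1 - z (s + t)^2)(1 - z (s - t)^2); z_M
    is the zero of the first factor. *)
Lemma wf_sqr : w * w = 1 - 2 * (g + 2) * z + (g - 2) ^ 2 * z ^ 2.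
Proof.
  unfold w, wf. apply sqrt_sqrt.
  assert (Hz := admissible_z_pos). assert (H := admissible_zM).
  destruct Had as (_ & Hg & _).
  assert (S1 : sqrt g * sqrt g = g) by (apply sqrt_sqrt; lra).
  assert (S2 : sqrt 2 * sqrt 2 = 2) by (apply sqrt_sqrt; lra).
  assert (P1 := sqrt_pos g). assert (P2 := sqrt_pos 2).
  set (s := sqrt g) in *. set (t := sqrt 2) in *.
  replace (1 - 2 * (g + 2) * z + (g - 2) ^ 2 * z ^ 2)
    with (1 - 2 * (s * s + t * t) * z + (s * s - t * t) ^ 2 * z ^ 2) by (rewrite S1, S2; ring).
  replace (1 - 2 * (s * s + t * t) * z + (s * s - t * t) ^ 2 * z ^ 2)
    with ((1 - z * (s + t) ^ 2) * (1 - z * (s - t) ^ 2)) by ring.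
  assert ((s - t) ^ 2 <= (s + t) ^ 2) by nra.
  apply Rmult_le_pos; nra.
Qed.

Lemma wf_nonneg : 0 <= w.
Proof. apply sqrt_pos. Qed.

(** On the line C = 1 + V both F and G are multiples of this quadratic, which does not involve m;
    the next lemmas extract F = G = 0 from it. *)
Lemma Vstar_eqn : V ^ 2 + V * (1 - (g - 2) * z) + 2 * z = 0.
Proof.
  assert (H := wf_sqr). unfold V, Vstar, V6, V8. fold w. destruct br; nra.
Qed.

(** The extreme cases are 1 + V_6 > 0 and V_8 < 0, that is w < 1 + (g - 2) z and w < 1 - (g - 2) z.
    The squares of the right sides exceed w^2 by 4 g z and 8 z. *)
Lemma Cstar_bounds : 0 < 1 + V < 1.
Proof.
  assert (H := wf_sqr). assert (Hw := wf_nonneg). assert (Hz := admissible_z_pos).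
  assert (H2 := admissible_two_gz). destruct Had as (_ & Hg & _).
  assert (Hgz : 0 < g * z) by (apply Rmult_lt_0_compat; lra).
  assert (Hz1 : z < 1 / 2) by nra.
  assert (Lt : forall u, 0 < u -> w * w < u * u -> w < u).
  { intros u Hu Hwu. apply Rnot_le_lt; intros N.
    generalize (Rmult_le_compat u w u w ltac:(lra) ltac:(lra) N N). lra. }
  assert (Hg2 : - z < (g - 2) * z <= z) by nra.
  assert (B1 : w < 1 + (g - 2) * z).
  { apply Lt; [lra|]. rewrite H.
    replace ((1 + (g - 2) * z) * (1 + (g - 2) * z))
      with (1 - 2 * (g + 2) * z + (g - 2) ^ 2 * z ^ 2 + 4 * (g * z)) by ring. lra. }
  assert (B2 : w < 1 - (g - 2) * z).
  { apply Lt; [lra|]. rewrite H.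
    replace ((1 - (g - 2) * z) * (1 - (g - 2) * z))
      with (1 - 2 * (g + 2) * z + (g - 2) ^ 2 * z ^ 2 + 8 * z) by ring. lra. }
  unfold V, Vstar, V6, V8. fold w. destruct br; lra.
Qed.

Lemma Gf_at_critical_point : (1 + V) * ((m + 1) * V + 2 * (m * z)) = V * (lam m g z + V).
Proof.
  transitivity (V * (lam m g z + V) + m * (V ^ 2 + V * (1 - (g - 2) * z) + 2 * z)).
  - unfold lam. ring.
  - rewrite Vstar_eqn. ring.
Qed.

Lemma Ff_at_critical_point :
  a3 m g z = (1 + V) * (1 + V + m * z) - a1 m g * ((1 + V) * (1 + V)) + a2 m g z * (1 + V).
Proof.
  match goal with |- _ = ?R =>
    transitivity (R + m * (g - 1) / 2 * (V ^ 2 + V * (1 - (g - 2) * z) + 2 * z)) end.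
  - unfold a1, a2, a3. field.
  - rewrite Vstar_eqn. ring.
Qed.

(** By G = 0 the expression equals 2 V (lambda + V), with -1 < V < 0 and lambda > 1. *)
Lemma gC_neg : gC m z V < 0.
Proof.
  unfold gC. rewrite Gf_at_critical_point. assert (Hb := Cstar_bounds).
  assert (Hz := admissible_z_pos). destruct Had as (Hm & Hg & _).
  assert (0 < m * g * z) by (repeat apply Rmult_lt_0_compat; lra).
  unfold lam. nra.
Qed.

(** With b = 1 + V the expression is (m - 2) b^2 + 2 b (1 - m g z) + m g z. It equals b (1 - b) + b
    (1 - 2 g z) + g z for m = 1 and 2 b (1 - 2 g z) + 2 g z for m = 2, where 0 < b < 1 and 2 g z <
    1. *)
Lemma gV_pos : 0 < gV m g z V.
Proof.
  assert (Hb := Cstar_bounds). assert (H := Vstar_eqn).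
  assert (Hz := admissible_z_pos). assert (H2 := admissible_two_gz).
  unfold gV, lam. destruct Had as (Hm & Hg & _).
  set (b := 1 + V) in *. replace V with (b - 1) in * by (unfold b; ring).
  destruct Hm as [-> | ->]; nra.
Qed.

(* At P6 the sign reduces to g w < 1 + (g + 2) z, which fails for small z: this is where zm g <= z is needed. *)
Lemma fV_neg : fV m g z V < 0.
Proof.
  assert (Hb := Cstar_bounds). assert (Hz := admissible_z_pos).
  assert (H2 := admissible_two_gz). assert (Hw := wf_nonneg). assert (Hs := wf_sqr).
  destruct Had as (Hm & Hg & Hbr).
  (* For m = 2 this is the claim divided by 1 + V; for m = 1 the claim has 2 (g + 1) in place of 2 g
     on the right and is weaker. *)
  assert (E : g - 1 - z * (2 + 3 * g - g ^ 2) < 2 * g * (1 + V)).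
  { unfold V, Vstar, V6, V8. fold w. destruct br.
    - assert (W : g * w < 1 + (g + 2) * z).
      (* In (1 + (g + 2) z)^2 - g^2 w^2, [Z] makes the constant and linear terms in z positive
         together, and [D] makes the coefficient of z^2 nonnegative. *)
      { assert (Z : g ^ 2 - 1 < z * (2 * (g + 2) * (1 + g ^ 2))).
        { destruct Hbr as [Hbr _]. unfold zm in Hbr.
          assert (P : 0 < (2 * g - 1) * (g + 1)) by nra.
          assert (Q : g - 1 <= z * ((2 * g - 1) * (g + 1))).
          { apply Rmult_le_reg_r with (/ ((2 * g - 1) * (g + 1))); [now apply Rinv_0_lt_compat|].
            rewrite Rmult_assoc, Rinv_r by lra. lra. }
          (* The excess of 2 (g + 2)(1 + g^2) over (2 g - 1)(g + 1)^2, the latter coming from the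
             z_m bound multiplied by g + 1. *)
          assert (0 < z * (g ^ 2 + 2 * g + 5)) by (apply Rmult_lt_0_compat; nra).
          assert (N : (g + 1) * (g - 1) <= (g + 1) * (z * ((2 * g - 1) * (g + 1))))
            by (apply Rmult_le_compat_l; lra).
          nra. }
        assert (D : 0 <= (g + 2) ^ 2 - g ^ 2 * (g - 2) ^ 2).
        { replace ((g + 2) ^ 2 - g ^ 2 * (g - 2) ^ 2)
            with ((2 + g * (3 - g)) * (g ^ 2 - g + 2)) by ring.
          apply Rmult_le_pos; nra. }
        assert (Sq : (g * w) * (g * w) < (1 + (g + 2) * z) * (1 + (g + 2) * z)).
        { replace ((g * w) * (g * w)) with (g ^ 2 * (w * w)) by ring. rewrite Hs.
          assert (0 <= z ^ 2 * ((g + 2) ^ 2 - g ^ 2 * (g - 2) ^ 2))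
            by (apply Rmult_le_pos; [nra | exact D]).
          nra. }
        apply Rsqr_incrst_0; unfold Rsqr; nra. }
      nra.
    - nra. }
  unfold fV. assert (a2 m g z - m * z - 2 * (a1 m g * (1 + V)) < 0); [|nra].
  unfold a1, a2. destruct Hm as [-> | ->]; nra.
Qed.
End CriticalPoint.

(** * Partial derivatives and the negative slope *)

Section PartialDerivatives.
Variables (m : R) (br : branch) (g z : R).
Hypothesis Had : admissible m br g z.
Let V := Vstar br g z.

Lemma G_C_eq : G_C m br g z = gC m z V.
Proof.
  unfold G_C, Gf, gC, Cstar. fold V. apply is_derive_unique. auto_derive; [trivial | ring].
Qed.

Lemma G_V_eq : G_V m br g z = gV m g z V.
Proof.
  unfold G_V, Gf, gV, Cstar. fold V. apply is_derive_unique. auto_derive; [trivial | ring].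
Qed.

Lemma F_C_eq : F_C m br g z = fC m z V.
Proof.
  assert (Hb := Cstar_bounds m br g z Had). fold V in Hb.
  assert (H := Ff_at_critical_point m br g z Had). fold V in H.
  unfold F_C, Ff, fC, Cstar. fold V. apply is_derive_unique.
  auto_derive; [trivial|]. rewrite H. field. lra.
Qed.

Lemma F_V_eq : F_V m br g z = fV m g z V.
Proof.
  assert (Hb := Cstar_bounds m br g z Had). fold V in Hb.
  unfold F_V, Ff, fV, Cstar. fold V. apply is_derive_unique.
  auto_derive; [lra|]. field. lra.
Qed.
End PartialDerivatives.

Definition neg_root (A B D : R) : R := (- B - sqrt (B * B - 4 * (A * D))) / (2 * A).

Section NegativeRoot.
Variables A B D c : R.
Hypotheses (A_pos : 0 < A) (D_neg : D < 0) (c_neg : c < 0) (Hc : A * c ^ 2 + B * c + D = 0).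

(** As A and D have opposite signs, so do the roots; c is the left one, where the convex parabola
    descends. Algebraically, c (2 A c + B) = A c^2 - D > 0. For the slope quadratic this is the
    inequality mu2 < mu1. *)
Lemma neg_root_slope : 2 * A * c + B < 0.
Proof.
  apply Rnot_le_lt. intros N.
  assert (A * c ^ 2 - D > 0) by (assert (0 < c ^ 2) by nra; nra).
  assert (c * (2 * A * c + B) = A * c ^ 2 - D) by nra. nra.
Qed.

Lemma neg_root_unique : c = neg_root A B D.
Proof.
  assert (Hs := neg_root_slope). unfold neg_root.
  replace (B * B - 4 * (A * D)) with ((- (2 * A * c + B)) * (- (2 * A * c + B))) by nra.
  rewrite sqrt_square by lra. field. lra.
Qed.
End NegativeRoot.

(** * Reduction of the field equation to Briot–Bouquet form *)

Section Reduction.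
Variables (m g z V c1 : R).
Let b := 1 + V.
Let e1 := m + 1.
Let e0 := (m + 1) * V + 2 * (m * z).
Let K := lam m g z + V.

(* With [C = b + x Y]: G = x (gV + gC Y + x red_G1) and F (1 + V) = C x (fV + fC Y + x red_F1). *)
Definition red_G1 (Y : fps) : fps :=
  fadd (fsub (fadd (fmul (fconst (2 * (b * e1))) Y) (fmul (fconst e0) (fmul Y Y)))
             (fconst (V + b + K)))
       (fmul fX (fsub (fmul (fconst e1) (fmul Y Y)) (fconst 1))).

Definition red_G (Y : fps) : fps :=
  fadd (fadd (fconst (gV m g z V)) (fmul (fconst (gC m z V)) Y)) (fmul fX (red_G1 Y)).

Definition red_F1 (Y : fps) : fps :=
  fadd (fadd (fsub (fadd (fmul (fconst (2 * b)) Y) (fmul (fconst (b + m * z)) (fmul Y Y)))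
                   (fconst (3 * (a1 m g * b))))
             (fconst (a2 m g z)))
       (fmul fX (fsub (fmul Y Y) (fconst (a1 m g)))).

Definition red_F (Y : fps) : fps :=
  fadd (fadd (fconst (fV m g z V)) (fmul (fconst (fC m z V)) Y)) (fmul fX (red_F1 Y)).

(** The remainder in (b + x) [red_G] = [red_mu] + [red_h] y + x [red_B], where b + x is the factor 1
    + V. *)
Definition red_B (y : fps) : fps :=
  let Y := fadd (fconst c1) y in fadd (fmul (fconst b) (red_G1 Y)) (red_G Y).

(** Here (b + x Y) [red_F] = b (fV + fC Y) + x ([red_A] + c1 [red_B]): the c1 part of C' = c1 + y +
    x y' has been moved to this side. *)
Definition red_A (y : fps) : fps :=
  let Y := fadd (fconst c1) y in
  fsub (fadd (fmul (fconst b) (red_F1 Y)) (fmul Y (red_F Y))) (fmul (fconst c1) (red_B y)).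

Definition red_mu : R := b * (gV m g z V + c1 * gC m z V).
Definition red_nu : R := b * (gV m g z V - fC m z V + 2 * (c1 * gC m z V)).
Definition red_h : R := b * gC m z V.

Definition ansatz (y : fps) : fps := fadd (fconst b) (fmul fX (fadd (fconst c1) y)).

Hypothesis HG : (1 + V) * ((m + 1) * V + 2 * (m * z)) = V * (lam m g z + V).
Hypothesis HF :
  a3 m g z = (1 + V) * (1 + V + m * z) - a1 m g * ((1 + V) * (1 + V)) + a2 m g z * (1 + V).
Hypothesis Hc1 : - gC m z V * c1 ^ 2 + (fC m z V - gV m g z V) * c1 + fV m g z V = 0.

Let v := fadd (fconst V) fX.

Lemma fconst_2 : fconst 2 = fadd (fconst 1) (fconst 1).
Proof. exact (fconst_add 1 1). Qed.

Lemma fconst_3 : fconst 3 = fadd (fconst 1) (fadd (fconst 1) (fconst 1)).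
Proof. rewrite <- !fconst_add. reflexivity. Qed.

Lemma fG_reduction Y : fG m g z v (fadd (fconst b) (fmul fX Y)) = fmul fX (red_G Y).
Proof.
  assert (H : fconst ((1 + V) * ((1 + V) * ((m + 1) * V + 2 * (m * z)) - V * (lam m g z + V)))
              = fconst 0) by (rewrite HG; f_equal; ring).
  (* The added constant is the value of G at the critical point. It vanishes by [HG], and with it
     the two sides agree as polynomials. *)
  transitivity (fadd (fmul fX (red_G Y))
    (fconst ((1 + V) * ((1 + V) * ((m + 1) * V + 2 * (m * z)) - V * (lam m g z + V))))).
  2:{ rewrite H. ring. }
  unfold fG, red_G, red_G1, v, b, e0, e1, K, gV, gC.
  replace (2 * m * z) with (2 * (m * z)) by ring.
  rewrite ?fscal_fconst.
  repeat rewrite ?fconst_add, ?fconst_sub, ?fconst_mul, ?fconst_2, ?fconst_3. ring.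
Qed.

Lemma fFhat_reduction Y :
  fFhat m g z v (fadd (fconst b) (fmul fX Y))
  = fmul (fadd (fconst b) (fmul fX Y)) (fmul fX (red_F Y)).
Proof.
  unfold fFhat. rewrite HF. unfold red_F, red_F1, v, b, fV, fC.
  cbv zeta. rewrite ?fscal_fconst.
  repeat rewrite ?fconst_add, ?fconst_sub, ?fconst_mul, ?fconst_2, ?fconst_3. ring.
Qed.

Lemma field_reduction y :
  fsub (fFhat m g z v (ansatz y))
       (fmul (fadd (fconst 1) v) (fmul (fderiv (ansatz y)) (fG m g z v (ansatz y))))
  = fmul fX (fsub (bb_rhs red_h red_A red_B y)
                  (fadd (fscal red_mu (feuler y)) (fscal red_nu y))).
Proof.
  unfold ansatz. rewrite fG_reduction, fFhat_reduction, fderiv_fX_mul.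
  set (Y := fadd (fconst c1) y).
  replace (feuler Y) with (feuler y).
  2:{ unfold Y, feuler, fadd, fconst. extensionality n. destruct n; simpl INR; ring. }
  assert (H : fconst (- gC m z V * c1 ^ 2 + (fC m z V - gV m g z V) * c1 + fV m g z V)
              = fconst 0) by now rewrite Hc1.
  (* The residual at order x is b times the slope quadratic at c1. It is added as a zero, so that
     what remains is a ring identity. *)
  match goal with |- ?L = ?R => transitivity (fadd R (fmul fX (fmul (fconst b)
    (fconst (- gC m z V * c1 ^ 2 + (fC m z V - gV m g z V) * c1 + fV m g z V))))) end.
  2:{ rewrite H. ring. }
  unfold bb_rhs, red_A, red_B. cbv zeta. fold Y. unfold red_G, red_F, red_h, red_mu, red_nu, v.
  rewrite ?fscal_fconst. generalize (red_G1 Y) (red_F1 Y). intros G1 F1. unfold Y, b.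
  replace (c1 ^ 2) with (c1 * c1) by ring.
  repeat rewrite ?fconst_add, ?fconst_sub, ?fconst_mul, ?fconst_opp, ?fconst_2.
  ring.
Qed.

Lemma formal_sol_iff y : y 0%nat = 0 ->
  formal_sol m g z V (ansatz y) <-> bb_solution red_mu red_nu red_h red_A red_B y.
Proof.
  intros y0. assert (E := field_reduction y).
  assert (En : forall n, bb_rhs red_h red_A red_B y n - (red_mu * (INR n * y n) + red_nu * y n)
    = fsub (fFhat m g z v (ansatz y))
       (fmul (fadd (fconst 1) v) (fmul (fderiv (ansatz y)) (fG m g z v (ansatz y)))) (S n)).
  { intros n. rewrite E, fX_mul_S. reflexivity. }
  split.
  - intros Hf. split; [exact y0|]. intros n. specialize (En (S n)).
    assert (Z := Rminus_diag_eq _ _ (Hf (S (S n)))). cbv zeta in Z.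
    match type of En with _ = ?R => change (R = 0) in Z; rewrite Z in En end. lra.
  - intros [_ Hb] n.
    assert (Z : fsub (fFhat m g z v (ansatz y))
       (fmul (fadd (fconst 1) v) (fmul (fderiv (ansatz y)) (fG m g z v (ansatz y)))) n = 0).
    (* Orders 0 and 1 hold for every y with y(0) = 0; order n + 2 is the Briot-Bouquet relation at
       index n + 1. *)
    { destruct n as [|[|n]].
      - rewrite E. apply fX_mul_0.
      - rewrite <- En. unfold bb_rhs, fsub. rewrite fX_mul_0, fmul_0.
        unfold fadd, feuler, fscal. rewrite y0. simpl INR. ring.
      - rewrite <- En, <- Hb. ring. }
    unfold fsub in Z. fold v. lra.
Qed.
End Reduction.

(** * The solution family *)

Definition Vp (br : branch) (p : R * R) : R := Vstar br (fst p) (snd p).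

Definition c1p (m : R) (br : branch) (p : R * R) : R :=
  neg_root (- gC m (snd p) (Vp br p))
    (fC m (snd p) (Vp br p) - gV m (fst p) (snd p) (Vp br p)) (fV m (fst p) (snd p) (Vp br p)).

Definition yp (m : R) (br : branch) (p : R * R) : fps :=
  let g := fst p in let z := snd p in let V := Vp br p in let c1 := c1p m br p in
  bb_sol (red_mu m g z V c1) (red_nu m g z V c1) (red_h m z V)
    (red_A m g z V c1) (red_B m g z V c1).

Definition cp (m : R) (br : branch) (p : R * R) : fps := ansatz (Vp br p) (c1p m br p) (yp m br p).

Ltac continuity_step :=
  lazymatch goal with
  | |- continuous (fun q => _ + _) _ => apply continuous_Rplus
  | |- continuous (fun q => _ - _) _ => apply continuous_Rminus
  | |- continuous (fun q => _ * _) _ => apply continuous_Rmult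
  | |- continuous (fun q => - _) _ => apply continuous_Ropp
  | |- continuous (fun q => _ ^ _) _ => apply continuous_pow
  | |- continuous (fun q => sqrt _) _ => apply continuous_Rsqrt
  | |- continuous fst _ => apply continuous_fst
  | |- continuous snd _ => apply continuous_snd
  | |- continuous (fun _ => ?c) _ => apply (continuous_const c)
  | |- _ => assumption
  end.

(** This covers z = z_M, where w vanishes: beyond it the radicand may be negative, and there [sqrt]
    is 0, which extends it continuously. *)
Lemma Vp_continuous br p : continuous (Vp br) p.
Proof.
  unfold Vp, Vstar, V6, V8, wf.
  destruct br; unfold Rdiv; repeat continuity_step.
Qed.

Section Tame.
Variables (m : R) (p : R * R) (V c : R * R -> R).
Hypotheses (cV : continuous V p) (cc : continuous c p).

Lemma gV_continuous : continuous (fun q => gV m (fst q) (snd q) (V q)) p.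
Proof. unfold gV, lam. repeat continuity_step. Qed.

Lemma gC_continuous : continuous (fun q => gC m (snd q) (V q)) p.
Proof. unfold gC. repeat continuity_step. Qed.

Lemma fV_continuous : continuous (fun q => fV m (fst q) (snd q) (V q)) p.
Proof.
  unfold fV, a1, a2, Rdiv. repeat continuity_step.
Qed.

Lemma fC_continuous : continuous (fun q => fC m (snd q) (V q)) p.
Proof. unfold fC. repeat continuity_step. Qed.

Ltac tame_step :=
  first
    [ apply tame_id
    | apply tame_X
    | apply tame_const; unfold gV, gC, fV, fC, lam, a1, a2, Rdiv; repeat continuity_step
    | apply tame_mul
    | apply tame_sub
    | apply tame_add ].

Lemma red_B_tame : tame p (fun q => red_B m (fst q) (snd q) (V q) (c q)).
Proof.
  change (tame p (fun q y => red_B m (fst q) (snd q) (V q) (c q) y)).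
  unfold red_B, red_G, red_G1. cbv zeta. repeat tame_step.
Qed.

Lemma red_A_tame : tame p (fun q => red_A m (fst q) (snd q) (V q) (c q)).
Proof.
  change (tame p (fun q y => red_A m (fst q) (snd q) (V q) (c q) y)).
  unfold red_A. cbv zeta. apply tame_sub.
  - unfold red_F, red_F1. repeat tame_step.
  - apply tame_mul; [repeat tame_step | apply red_B_tame].
Qed.
End Tame.

Section Family.
Variables (m : R) (br : branch) (g z : R).
Hypothesis Had : admissible m br g z.
Let p := (g, z).

Lemma c1p_continuous : continuous (c1p m br) p.
Proof.
  assert (HV := Vp_continuous br p).
  assert (C1 := gC_continuous m p (Vp br) HV). assert (C2 := gV_continuous m p (Vp br) HV).
  assert (C3 := fC_continuous m p (Vp br) HV). assert (C4 := fV_continuous m p (Vp br) HV).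
  assert (H := gC_neg m br g z Had). unfold c1p, neg_root.
  apply continuous_Rdiv; repeat continuity_step.
  unfold Vp, p; simpl. lra.
Qed.

Lemma c1p_spec c1 : is_c1 m br g z c1 -> c1 = c1p m br p.
Proof.
  intros [Hc E]. unfold c1p. apply neg_root_unique; auto.
  - assert (H := gC_neg m br g z Had). unfold Vp; simpl. lra.
  - exact (fV_neg m br g z Had).
  - rewrite G_C_eq, F_C_eq, G_V_eq, F_V_eq in E by assumption. exact E.
Qed.

Variable c1 : R.
Hypothesis Hc1 : is_c1 m br g z c1.
Let V := Vstar br g z.

Lemma c1_eqn : - gC m z V * c1 ^ 2 + (fC m z V - gV m g z V) * c1 + fV m g z V = 0.
Proof.
  destruct Hc1 as [_ E]. now rewrite G_C_eq, F_C_eq, G_V_eq, F_V_eq in E.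
Qed.

(* red_mu and red_nu are C_* mu1 and C_* (mu1 - mu2). *)
Lemma red_mu_pos : 0 < red_mu m g z V c1.
Proof.
  assert (H1 := gC_neg m br g z Had). assert (H2 := gV_pos m br g z Had).
  assert (H3 := Cstar_bounds m br g z Had). fold V in H1, H2, H3. destruct Hc1 as [Hc _].
  unfold red_mu. apply Rmult_lt_0_compat; nra.
Qed.

Lemma red_nu_pos : 0 < red_nu m g z V c1.
Proof.
  assert (H1 := gC_neg m br g z Had). assert (H2 := fV_neg m br g z Had).
  assert (H3 := Cstar_bounds m br g z Had). fold V in H1, H2, H3. destruct Hc1 as [Hc _].
  assert (S := neg_root_slope (- gC m z V) (fC m z V - gV m g z V) (fV m g z V) c1
    ltac:(lra) H2 Hc c1_eqn).
  unfold red_nu. apply Rmult_lt_0_compat; lra.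
Qed.

Lemma red_A_causal : causal (red_A m g z V c1).
Proof.
  intros n y y' H.
  (* Causality is the first clause of [tame], read with V and c1 frozen. *)
  exact (proj1 (red_A_tame m p (fun _ => V) (fun _ => c1)
    (continuous_const _ _) (continuous_const _ _)) p n y y' H).
Qed.

Lemma red_B_causal : causal (red_B m g z V c1).
Proof.
  intros n y y' H.
  exact (proj1 (red_B_tame m p (fun _ => V) (fun _ => c1)
    (continuous_const _ _) (continuous_const _ _)) p n y y' H).
Qed.

Lemma cp_formal_sol :
  cp m br p 0%nat = Cstar br g z /\ cp m br p 1%nat = c1 /\ formal_sol m g z V (cp m br p).
Proof.
  assert (E := c1p_spec c1 Hc1).
  assert (B : bb_solution (red_mu m g z V c1) (red_nu m g z V c1) (red_h m z V)
    (red_A m g z V c1) (red_B m g z V c1) (yp m br p)).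
  { unfold yp. rewrite <- E. unfold Vp; simpl. fold V.
    apply bb_sol_correct.
    - apply red_A_causal.
    - apply red_B_causal.
    - apply red_mu_pos.
    - apply red_nu_pos. }
  unfold cp. rewrite <- E. unfold Vp; simpl. fold V.
  split; [|split].
  - unfold ansatz, fadd. rewrite fX_mul_0. unfold Cstar; fold V. simpl. ring.
  - unfold ansatz, fadd. rewrite fX_mul_S, (proj1 B). simpl. ring.
  - apply formal_sol_iff; [| | apply c1_eqn | apply B | exact B].
    + apply (Gf_at_critical_point m br g z Had).
    + apply (Ff_at_critical_point m br g z Had).
Qed.

Lemma formal_sol_unique (c : fps) :
  c 0%nat = Cstar br g z -> c 1%nat = c1 -> formal_sol m g z V c -> c = cp m br p.
Proof.
  intros H0 H1 Hc. destruct cp_formal_sol as (K0 & K1 & Kc).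
  (* Any series with the prescribed first two coefficients is an [ansatz], with y_0 = 0 and y_n the
     coefficient of order n + 1. *)
  assert (Rep : forall d : fps, d 0%nat = Cstar br g z -> d 1%nat = c1 ->
    exists y : fps, y 0%nat = 0 /\ d = ansatz V c1 y).
  { intros d D0 D1. exists (fun n => match n with O => 0 | S _ => d (S n) end).
    split; [reflexivity|]. extensionality n. unfold ansatz, fadd.
    destruct n as [|[|n]]; rewrite ?fX_mul_0, ?fX_mul_S; simpl;
      rewrite ?D0, ?D1; unfold Cstar; fold V; ring. }
  destruct (Rep c H0 H1) as (y & y0 & ->). destruct (Rep (cp m br p) K0 K1) as (y' & y0' & E).
  rewrite E in *. f_equal.
  eapply bb_solution_unique.
  - apply red_A_causal.
  - apply red_B_causal.
  - apply red_mu_pos.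
  - apply red_nu_pos.
  - apply formal_sol_iff; auto using c1_eqn.
    + apply (Gf_at_critical_point m br g z Had).
    + apply (Ff_at_critical_point m br g z Had).
  - apply formal_sol_iff; auto using c1_eqn.
    + apply (Gf_at_critical_point m br g z Had).
    + apply (Ff_at_critical_point m br g z Had).
Qed.

Lemma yp_tame_data :
  continuous (fun q => red_mu m (fst q) (snd q) (Vp br q) (c1p m br q)) p /\
  continuous (fun q => red_nu m (fst q) (snd q) (Vp br q) (c1p m br q)) p /\
  continuous (fun q => red_h m (snd q) (Vp br q)) p.
Proof.
  assert (HV := Vp_continuous br p). assert (Hc := c1p_continuous).
  unfold red_mu, red_nu, red_h, gV, gC, fC, lam.
  split; [|split]; repeat continuity_step.
Qed.

Lemma cp_continuous n : continuous (fun q => cp m br q n) p.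
Proof.
  destruct yp_tame_data as (D1 & D2 & D3).
  assert (HV := Vp_continuous br p). assert (Hc := c1p_continuous).
  assert (Y : continuous_coefs (yp m br) p).
  { unfold yp. apply (bb_sol_continuous p
      (fun q => red_mu m (fst q) (snd q) (Vp br q) (c1p m br q))
      (fun q => red_nu m (fst q) (snd q) (Vp br q) (c1p m br q))
      (fun q => red_h m (snd q) (Vp br q))
      (fun q => red_A m (fst q) (snd q) (Vp br q) (c1p m br q))
      (fun q => red_B m (fst q) (snd q) (Vp br q) (c1p m br q))); auto.
    - now apply red_A_tame.
    - now apply red_B_tame.
    - rewrite <- (c1p_spec c1 Hc1). apply red_mu_pos.
    - rewrite <- (c1p_spec c1 Hc1). apply red_nu_pos. }
  unfold cp, ansatz.
  apply (continuous_ext (fun q => fconst (1 + Vp br q) n +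
    match n with O => 0 | S k => fconst (c1p m br q) k + yp m br q k end)).
  { intros q. unfold fadd at 1. destruct n; rewrite ?fX_mul_0, ?fX_mul_S; reflexivity. }
  apply continuous_Rplus.
  - destruct n; simpl; repeat continuity_step.
  - destruct n as [|n]; [apply continuous_const|].
    apply continuous_Rplus; [|apply Y]. destruct n; simpl; [exact Hc | apply continuous_const].
Qed.

Lemma cp_locally_bounded :
  exists r M, 0 < r <= 1 /\ 1 <= M /\
    locally p (fun q => forall n, fnorm r (cp m br q) n <= M).
Proof.
  destruct yp_tame_data as (D1 & D2 & D3).
  assert (HV := Vp_continuous br p). assert (Hc := c1p_continuous).
  destruct (bb_sol_locally_bounded p
      (fun q => red_mu m (fst q) (snd q) (Vp br q) (c1p m br q))
      (fun q => red_nu m (fst q) (snd q) (Vp br q) (c1p m br q))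
      (fun q => red_h m (snd q) (Vp br q))
      (fun q => red_A m (fst q) (snd q) (Vp br q) (c1p m br q))
      (fun q => red_B m (fst q) (snd q) (Vp br q) (c1p m br q))) as (r & Hr & L); auto.
  - now apply red_A_tame.
  - now apply red_B_tame.
  - rewrite <- (c1p_spec c1 Hc1). apply red_mu_pos.
  - rewrite <- (c1p_spec c1 Hc1). apply red_nu_pos.
  - exists r, (1 + (Rabs (Vp br p) + 1) + (Rabs (c1p m br p) + 1 + 1)).
    split; [exact Hr|]. split.
    { generalize (Rabs_pos (Vp br p)) (Rabs_pos (c1p m br p)). lra. }
    generalize (filter_and (F := locally p) _ _ L (filter_and (F := locally p) _ _
      (continuous_locally_abs_le _ p HV) (continuous_locally_abs_le _ p Hc))).
    apply filter_imp. intros q (Hy & HVq & Hcq) n. unfold cp, ansatz.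
    specialize (Hy n). fold (yp m br q) in Hy.
    change (fnorm r (yp m br q) n <= 1) in Hy.
    eapply Rle_trans; [apply fnorm_add; lra|]. rewrite fnorm_const.
    apply Rplus_le_compat.
    + eapply Rle_trans; [apply Rabs_triang|]. rewrite Rabs_R1. lra.
    + eapply Rle_trans; [apply fnorm_X_mul; lra|].
      assert (N := fnorm_nonneg r (fadd (fconst (c1p m br q)) (yp m br q)) n ltac:(lra)).
      assert (T := fnorm_add r (fconst (c1p m br q)) (yp m br q) n ltac:(lra)).
      rewrite fnorm_const in T. nra.
Qed.
End Family.

(** * From the coefficients to the analytic solution *)

Lemma fnorm_bound_coef r a M n :
  0 < r -> (forall n, fnorm r a n <= M) -> Rabs (a n) <= M * (/ r) ^ n.
Proof.
  intros Hr HM. assert (P : 0 < r ^ n) by now apply pow_lt.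
  rewrite pow_inv. apply Rmult_le_reg_r with (r ^ n); [exact P|].
  rewrite Rmult_assoc, Rinv_l, Rmult_1_r by lra.
  eapply Rle_trans; [apply (fnorm_ge_term r a n n); [lra | apply le_n] | apply HM].
Qed.

Lemma is_derive_shift (f : R -> R) (V0 V l : R) :
  is_derive f (V - V0) l -> is_derive (fun W => f (W - V0)) V l.
Proof.
  intros H. rewrite <- (Rmult_1_l l).
  apply (is_derive_comp f (fun W => W - V0)); [exact H|].
  auto_derive; [trivial | ring].
Qed.

(** Plain convergence at 3 r / 4 forces the terms there to tend to 0, so the radius of convergence
    is at least 3 r / 4 and the series is absolutely summable at r / 2. *)
Lemma evals_of_pseries (d : fps) (f : R -> R) r :
  0 < r -> (forall x, Rabs x < r -> is_pseries d x (f x)) -> evals (r / 2) d f.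
Proof.
  intros Hr H. split.
  - apply abs_conv_inside; [lra|]. apply Rbar_lt_le_trans with (3 * r / 4).
    { simpl. lra. }
    apply Rbar_not_lt_le. intros N.
    replace (3 * r / 4) with (Rabs (3 * r / 4)) in N by (apply Rabs_pos_eq; lra).
    apply (CV_disk_outside _ _ N).
    assert (E := H (3 * r / 4) ltac:(rewrite Rabs_pos_eq; lra)).
    apply is_pseries_R in E. apply ex_series_lim_0. eexists. exact E.
  - intros x Hx. apply is_pseries_unique, H. lra.
Qed.

Lemma evals_pseries_0 r a f : 0 < r -> evals r a f -> a 0%nat = f 0.
Proof.
  intros Hr [_ H]. rewrite <- H by (rewrite Rabs_R0; lra). now rewrite PSeries_0.
Qed.

Lemma evals_is_derive_0 r a f : 0 < r -> evals r a f -> is_derive f 0 (a 1%nat).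
Proof.
  intros Hr [Ha H].
  apply (is_derive_ext_loc (PSeries a)).
  - exists (mkposreal r Hr). intros y Hy. apply H.
    replace y with (y - 0) by ring. exact Hy.
  - replace (a 1%nat) with (PSeries (PS_derive a) 0).
    + apply is_derive_PSeries. apply (abs_conv_lt_radius r); [exact Ha | rewrite Rabs_R0; lra].
    + rewrite PSeries_0. unfold PS_derive. simpl. ring.
Qed.

Section Solution.
Variables (m : R) (br : branch) (g z c1 : R).
Hypotheses (Had : admissible m br g z) (Hc1 : is_c1 m br g z c1).
Let V := Vstar br g z.
Let c := cp m br (g, z).

(** The power series of f at V is a formal solution with the same first two coefficients, hence is
    c. *)
Lemma analytic_solution_unique (f : R -> R) delta : 0 < delta ->
  analytic_on f (V - delta) (V + delta) -> f V = Cstar br g z -> is_derive f V c1 ->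
  (forall W, Rabs (W - V) < delta -> Derive f W * Gf m g z W (f W) = Ff m g z W (f W)) ->
  exists delta', 0 < delta' /\ forall W, Rabs (W - V) < delta' -> f W = PSeries c (W - V).
Proof.
  intros Hd Han f0 f1 Hode.
  assert (Hb := Cstar_bounds m br g z Had). fold V in Hb.
  destruct (Han V ltac:(lra)) as (r & Hr & d & Hrd).
  set (F := fun x => f (V + x)).
  assert (EF : evals (r / 2) d F).
  { apply evals_of_pseries; [exact Hr|]. intros x Hx. unfold F.
    replace x with (V + x - V) at 1 by ring. apply Hrd.
    now replace (V + x - V) with x by ring. }
  (* The three bounds keep x inside the expansion of f, inside the domain of the equation, and away
     from the pole 1 + V + x = 0. *)
  set (s := Rmin (r / 4) (Rmin (delta / 2) (1 + V))).
  assert (Hs : 0 < s) by (repeat apply Rmin_pos; lra).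
  assert (S1 : s <= r / 4) by apply Rmin_l.
  assert (S2 : s <= delta / 2) by (eapply Rle_trans; [apply Rmin_r | apply Rmin_l]).
  assert (S3 : s <= 1 + V) by (eapply Rle_trans; [apply Rmin_r | apply Rmin_r]).
  assert (Es : evals s d F) by (apply (evals_restrict (r / 2)); [lra | exact EF]).
  assert (DF : forall x, Derive F x = Derive f (V + x)).
  { intros x. unfold F. unfold Derive. f_equal. apply Lim_ext. intros h.
    now rewrite <- Rplus_assoc. }
  exists s. split; [exact Hs|].
  assert (Ed : d = c).
  { apply (formal_sol_unique m br g z Had c1 Hc1).
    - rewrite (evals_pseries_0 s d F Hs Es). unfold F. now rewrite Rplus_0_r.
    - assert (D := evals_is_derive_0 s d F Hs Es).
      apply is_derive_unique in D. rewrite <- D, DF, Rplus_0_r. now apply is_derive_unique.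
    - apply (ode_formal_sol _ _ _ _ s d F Hs Es).
      + intros x Hx. rewrite DF. unfold F. apply Hode.
        replace (V + x - V) with x by ring. lra.
      + intros x Hx. apply Rabs_lt_between in Hx. fold V. lra. }
  intros W HW. rewrite <- Ed, (proj2 Es) by exact HW. unfold F. f_equal. ring.
Qed.

(** The margin between r / 2 and 3 r / 4 leaves room for the centre and the point to move together;
    nearby terms are then dominated by M (3/4)^n. *)
Lemma solution_continuous r M V0 : 0 < r <= 1 -> 1 <= M ->
  locally (g, z) (fun q => forall n, fnorm r (cp m br q) n <= M) ->
  Rabs (V0 - V) < r / 2 ->
  continuous (fun u : (R * R) * R => PSeries (cp m br (fst u)) (snd u - Vp br (fst u)))
    ((g, z), V0) /\
  locally ((g, z), V0) (fun u => ex_pseries (cp m br (fst u)) (snd u - Vp br (fst u))).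
Proof.
  intros Hr HM HL HV0.
  assert (Cd : continuous (fun u : (R * R) * R => snd u - Vp br (fst u)) ((g, z), V0)).
  { apply continuous_Rminus; [apply continuous_snd|].
    apply (continuous_comp fst (Vp br)); [apply continuous_fst | apply Vp_continuous]. }
  assert (Ln : locally ((g, z), V0)
    (fun u : (R * R) * R => forall n, fnorm r (cp m br (fst u)) n <= M)).
  { exact (continuous_fst (g, z) V0 _ HL). }
  assert (Lx : locally ((g, z), V0)
    (fun u : (R * R) * R => Rabs (snd u - Vp br (fst u)) < 3 / 4 * r)).
  { generalize (continuous_eps _ _ Cd (r / 4) ltac:(lra)). apply filter_imp. simpl.
    intros u Hu. unfold Vp at 2 in Hu. simpl in Hu. fold V in Hu.
    replace (snd u - Vp br (fst u)) with ((snd u - Vp br (fst u) - (V0 - V)) + (V0 - V)) by ring.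
    eapply Rle_lt_trans; [apply Rabs_triang | lra]. }
  split.
  - apply (Series_continuous (fun n (u : (R * R) * R) =>
      cp m br (fst u) n * (snd u - Vp br (fst u)) ^ n) _ M (3 / 4)); [lra| |].
    + intros n. apply continuous_Rmult.
      * apply (continuous_comp fst (fun q => cp m br q n)); [apply continuous_fst|].
        exact (cp_continuous m br g z Had c1 Hc1 n).
      * apply continuous_pow, Cd.
    + generalize (filter_and (F := locally ((g, z), V0)) _ _ Ln Lx). apply filter_imp.
      intros u [H1 H2] n. assert (B := fnorm_bound_coef r _ M n ltac:(lra) H1).
      rewrite Rabs_mult, <- RPow_abs.
      replace (3 / 4) with (/ r * (3 / 4 * r)) by (field; lra).
      rewrite Rpow_mult_distr, <- Rmult_assoc.
      apply Rmult_le_compat; [apply Rabs_pos | apply pow_le, Rabs_pos | exact B |].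
      apply pow_incr. split; [apply Rabs_pos | lra].
  - generalize (filter_and (F := locally ((g, z), V0)) _ _ Ln Lx). apply filter_imp.
    intros u [H1 H2]. apply CV_radius_inside, (abs_conv_lt_radius r); [now exists M|]. apply Rlt_trans with (3 / 4 * r); [exact H2 | lra].
Qed.
End Solution.

Theorem mainTheorem4 (m : R) (br : branch) (g z c1 : R) :
  admissible m br g z ->
  is_c1 m br g z c1 ->
  exists c : nat -> R,
    (* existence and uniqueness of the formal solution *)
    (c O = Cstar br g z /\ c 1%nat = c1 /\ formal_sol m g z (Vstar br g z) c) /\
    (forall c' : nat -> R,
        c' O = Cstar br g z -> c' 1%nat = c1 -> formal_sol m g z (Vstar br g z) c' ->
        c' = c) /\
    (* coefficient bounds *)
    (forall alpha, 1 < alpha < 2 ->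
       exists K, 1 < K /\
         forall l : nat, (2 <= l)%nat ->
           Rabs (c l) <= Rpower K (INR l - alpha) / INR l ^ 3) /\
    (* convergence, analyticity, ODE, uniqueness, continuous dependence *)
    exists eps, 0 < eps /\
      (forall V, Rabs (V - Vstar br g z) < eps ->
         ex_series (fun l => Rabs (c l * (V - Vstar br g z) ^ l))) /\
      analytic_on (fun V => PSeries c (V - Vstar br g z))
                  (Vstar br g z - eps) (Vstar br g z + eps) /\
      PSeries c (Vstar br g z - Vstar br g z) = Cstar br g z /\
      is_derive (fun V => PSeries c (V - Vstar br g z)) (Vstar br g z) c1 /\
      (forall V, Rabs (V - Vstar br g z) < eps ->
         Derive (fun W => PSeries c (W - Vstar br g z)) V
           * Gf m g z V (PSeries c (V - Vstar br g z))
         = Ff m g z V (PSeries c (V - Vstar br g z))) /\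
      (forall (f : R -> R) (delta : R), 0 < delta ->
         analytic_on f (Vstar br g z - delta) (Vstar br g z + delta) ->
         f (Vstar br g z) = Cstar br g z ->
         is_derive f (Vstar br g z) c1 ->
         (forall V, Rabs (V - Vstar br g z) < delta ->
            Derive f V * Gf m g z V (f V) = Ff m g z V (f V)) ->
         exists delta', 0 < delta' /\
           forall V, Rabs (V - Vstar br g z) < delta' ->
             f V = PSeries c (V - Vstar br g z)) /\
      (forall V0, Rabs (V0 - Vstar br g z) < eps ->
         forall eta, 0 < eta ->
         exists delta, 0 < delta /\
           forall (g' z' c1' : R) (c' : nat -> R),
             admissible m br g' z' -> is_c1 m br g' z' c1' ->
             c' O = Cstar br g' z' -> c' 1%nat = c1' ->
             formal_sol m g' z' (Vstar br g' z') c' ->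
             Rabs (g' - g) < delta -> Rabs (z' - z) < delta ->
             forall V, Rabs (V - V0) < delta ->
               ex_pseries c' (V - Vstar br g' z') /\
               Rabs (PSeries c' (V - Vstar br g' z')
                     - PSeries c (V0 - Vstar br g z)) < eta).
Proof.
  intros Had Hc1. set (Vs := Vstar br g z).
  destruct (cp_formal_sol m br g z Had c1 Hc1) as (K0 & K1 & Kf). fold Vs in Kf.
  destruct (cp_locally_bounded m br g z Had c1 Hc1) as (r & M & Hr & HM & HL).
  assert (HN := locally_singleton _ _ HL). cbv beta in HN.
  assert (Hb := Cstar_bounds m br g z Had). fold Vs in Hb.
  set (c := cp m br (g, z)) in *.
  assert (Hconv : abs_conv r c) by now exists M.
  assert (Ec : evals r c (PSeries c)) by now apply evals_PSeries.
  exists c. split; [auto|]. split; [|split].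
  - intros c'. exact (formal_sol_unique m br g z Had c1 Hc1 c').
  - intros alpha Halpha.
    apply (geometric_to_power_bound c M (/ r) alpha HM); [| |exact Halpha].
    + rewrite <- Rinv_1. apply Rinv_le_contravar; lra.
    + intros l. apply fnorm_bound_coef; [lra | exact HN].
  (* The bound r / 2 is what joint continuity requires; 1 + [Vs] keeps the interval to the right of
     V = -1, where F has its pole. *)
  - set (eps := Rmin (r / 2) (1 + Vs)). exists eps.
    assert (He : 0 < eps) by (apply Rmin_pos; lra).
    assert (He1 : eps <= r / 2) by apply Rmin_l.
    assert (He2 : eps <= 1 + Vs) by apply Rmin_r.
    assert (Hrad : forall x, Rabs x < eps -> Rbar_lt (Rabs x) (CV_radius c)).
    { intros x Hx. apply (abs_conv_lt_radius r); [exact Hconv | lra]. }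
    split; [exact He|]. split; [|split; [|split; [|split; [|split; [|split]]]]].
    + intros V HV. apply CV_disk_inside, Hrad, HV.
    + intros x0 Hx0. apply (abs_conv_analytic r c Vs Hconv). lra.
    + rewrite Rminus_diag, PSeries_0. exact K0.
    + apply is_derive_shift. rewrite Rminus_diag. rewrite <- K1.
      apply (evals_is_derive_0 r); [lra | exact Ec].
    + intros V HV.
      assert (D : Derive (fun W => PSeries c (W - Vs)) V = Derive (PSeries c) (V - Vs)).
      { apply is_derive_unique, is_derive_shift, Derive_correct.
        now apply ex_derive_PSeries, Hrad. }
      rewrite D. replace V with (Vs + (V - Vs)) at 2 4 by ring.
      apply (formal_sol_ode m g z Vs r c (PSeries c)); auto; [lra | lra |].
      apply Rabs_lt_between in HV. lra.
    + intros f delta. exact (analytic_solution_unique m br g z c1 Had Hc1 f delta).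
    + intros V0 HV0 eta Heta.
      destruct (solution_continuous m br g z c1 Had Hc1 r M V0 Hr HM HL
        ltac:(fold Vs; lra)) as [C1 C2].
      generalize (filter_and (F := locally ((g, z), V0)) _ _
        (continuous_eps _ _ C1 eta Heta) C2).
      intros [d Hd]. exists d. split; [apply cond_pos|].
      intros g' z' c1' c' Had' Hc1' H0 H1 Hf Hg Hz V HV.
      (* Uniqueness identifies [c'] with the member of the family at (g', z'), so joint continuity
         at ((g, z), V0) applies. *)
      rewrite (formal_sol_unique m br g' z' Had' c1' Hc1' c' H0 H1 Hf).
      destruct (Hd ((g', z'), V)) as [X1 X2].
      { split; [split|]; assumption. }
      split; [exact X2 | exact X1].
Qed.
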